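(* Let $K\in L_2(\mathbb R)$ be a kernel (satisfying the standing assumptions below) with $S_K>0$, and let $f\in L_2(\mathbb R)$ be a probability density. (i) (Smooth case) If for some integer $k\ge1$, $f$ has a $k$-th derivative $f^{(k)}\in L_1\cap L_2$, then the sequence $n^{2k/(2k+1)}\Phi(n,f,K)$, $n\ge1$, is bounded. (ii) (Supersmooth case) If for some $\alpha>0$ and $\gamma>0$ the integral $I_{\alpha,\gamma}(f)=\int_{\mathbb R} e^{\gamma|t|^\alpha}|\varphi_f(t)|^2dt$ is finite, then the sequence $\frac{n}{(\log n)^{1/\alpha}}\Phi(n,f,K)$, $n\ge2$, is bounded.
   Context: A kernel is an integrable function $K:\mathbb R\to\mathbb R$ with $\int K=1$; standing assumptions: $K$ is bounded, continuous at $0$, and $\int K^2<2K(0)$. For a sample $X_1,\dots,X_n$ i.i.d. with density $f$, bandwidth $h>0$, $f_{n,K,h}(x)=\frac1n\sum_{i=1}^n K_h(x-X_i)$ with $K_h(x)=K(x/h)/h$. $\mathrm{MISE}_f(f_{n,K,h})=E_f\int (f_{n,K,h}-f)^2$, and $\Phi(n,f,K)=\min_{h>0}\mathrm{MISE}_f(f_{n,K,h})$. $\varphi_K(t)=\int e^{itx}K(x)dx$, $\varphi_f(t)=\int e^{itx}f(x)dx$. $S_K=\inf\{t\ge0: |\varphi_K(t)-1|\ne0\}$, i.e. the largest $r$ such that $\varphi_K\equiv1$ on $[0,r]$. *)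

(* Defs.v *)
From HB Require Import structures.
From mathcomp Require Import all_boot all_order all_algebra.
From mathcomp Require Import all_classical all_reals all_analysis.
Set Implicit Arguments. Unset Strict Implicit. Unset Printing Implicit Defensive.
Import Order.TTheory GRing.Theory Num.Theory.
Import numFieldNormedType.Exports.
Local Open Scope classical_set_scope.
Local Open Scope ring_scope.
Local Open Scope ereal_scope.

Section KDE.
Context {R : realType}.
Notation mu := (@lebesgue_measure R).

Definition Kh (K : R -> R) (h : R) (x : R) : R := (K (x / h) / h)%R.

Definition kde (K : R -> R) (h : R) (s : seq R) (x : R) : R :=
  ((size s)%:R^-1 * \sum_(X <- s) Kh K h (x - X))%R.

(* E_f[g(X_1,...,X_n)] for X_1,...,X_n i.i.d. with density f, i.e. the
   integral of g against the joint density prod_i f(x_i) on R^n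
   (written as an iterated Lebesgue integral; used for g >= 0). *)
Fixpoint Eiid (f : R -> R) (n : nat) (g : seq R -> \bar R) : \bar R :=
  match n with
  | 0%N => g [::]
  | n'.+1 => \int[mu]_x ((f x)%:E * Eiid f n' (fun s => g (x :: s)))
  end.

Definition MISE (f K : R -> R) (n : nat) (h : R) : \bar R :=
  Eiid f n (fun s => \int[mu]_x (((kde K h s x - f x) ^+ 2)%R)%:E).

Definition Phi (n : nat) (f K : R -> R) : \bar R :=
  ereal_inf [set MISE f K n h | h in [set h : R | (0 < h)%R]].

Definition ft_re (g : R -> R) (t : R) : R := fine (\int[mu]_x ((cos (t * x) * g x)%R)%:E).
Definition ft_im (g : R -> R) (t : R) : R := fine (\int[mu]_x ((sin (t * x) * g x)%R)%:E).

Definition ft_abs2 (g : R -> R) (t : R) : R := (ft_re g t ^+ 2 + ft_im g t ^+ 2)%R.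

(* S_K = inf { t >= 0 : |phi_K(t) - 1| <> 0 }  (in \bar R; inf of empty set = +oo) *)
Definition S_K (K : R -> R) : \bar R :=
  ereal_inf [set t%:E | t in [set t : R | (0 <= t)%R /\
     (ft_re K t, ft_im K t) <> (1%R, 0%R)]].

Definition is_kernel (K : R -> R) : Prop :=
  [/\ mu.-integrable setT (EFin \o K),
      \int[mu]_x (K x)%:E = 1,
      (exists M : R, forall x, `|K x| <= M)%R,
      {for 0%R, continuous K} &
      \int[mu]_x ((K x ^+ 2)%R)%:E < ((2 * K 0)%R)%:E].

Definition in_L2 (g : R -> R) : Prop :=
  mu.-integrable setT (fun x => ((g x ^+ 2)%R)%:E) /\ measurable_fun setT g.

Definition is_density (f : R -> R) : Prop :=
  [/\ measurable_fun setT f, (forall x, 0 <= f x)%R & \int[mu]_x (f x)%:E = 1].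

End KDE.

(* Main.v *)
(* With the Poisson kernel p_d(u) = 2d / (d^2 + u^2) = int e^{-d|t|} cos(tu) dt,
     int e^{-d|t|} |g^(t)|^2 dt = int int g(x) g(y) p_d(x - y) dy dx
   for g in L1, where int p_d = c does not depend on d.  Bounding the right-hand
   side by AM-GM and letting d -> 0 gives int |g^|^2 <= c int g^2; for bounded
   continuous g dominated convergence gives the reverse inequality, and for
   arbitrary g in L1 the averages of g over ]x, x + s] (s -> 0) give
   c int g^2 <= 2 int |g^|^2 by Lebesgue differentiation and Fatou.  These
   two inequalities replace Plancherel's theorem.

   The risk is at most int (K_h * f - f)^2 + (1 / (n h)) int K^2.  Since
   K^(ht) = 1 for h |t| <= s0, the bias is at most a constant times the integral
   of |f^|^2 over |t| > s0 / h.  In the supersmooth case this is at most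
   I_{alpha,gamma}(f) / n for h = s0 (ln n / gamma)^{-1/alpha}.  In the smooth
   case one compares the k-th forward difference of f with step s = pi / |t|,
   whose transform at t has modulus 2^k |f^(t)|, with s^k times the k-fold average
   of f^(k); this gives |f^(t)|^2 <= (s^2 / 2)^k |(f^(k))^(t)|^2 without
   knowing that the intermediate derivatives are integrable. *)

Require Import Defs.
From HB Require Import structures.
From mathcomp Require Import all_boot all_order all_algebra.
From mathcomp Require Import all_classical all_reals all_analysis.
From mathcomp Require Import measurable_realfun ring lra.
Set Implicit Arguments. Unset Strict Implicit. Unset Printing Implicit Defensive.
Import Order.TTheory GRing.Theory Num.Theory.
Import numFieldNormedType.Exports.
Local Open Scope classical_set_scope.
Local Open Scope ring_scope.

(** * Affine change of variables *)

Section change_of_variables.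
Context {R : realType}.
Implicit Types (a b c : R) (f g : R -> R).
Notation mu := (@lebesgue_measure R).

(** Only rates are claimed, so the L2 norm and the Fourier energy need only be comparable: the lower
    bound on the energy, with its stray factor 2, is applied to the bias, and the upper bound only
    to f^(k). Damping by e^{-d|t|} is forced because the double integrals behind |g^|^2 do not
    converge absolutely in t; this weight has a transform that is elementary, positive and a
    rescaling of one profile, whose mass need not be evaluated. A second obstacle is f^(k): it is
    integrable but possibly discontinuous, so the fundamental theorem for continuous derivatives
    does not apply. The formula is proved instead for everywhere differentiable functions with
    integrable derivative, by a covering in the style of Vitali and Caratheodory. On the statistical
    side [Eiid] is an iterated integral, so the risk is computed exactly by induction on n, peeling
    off one observation and carrying a deterministic offset. *)

Lemma measurable_affine a b : measurable_fun setT (fun x : R => a * x + b).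
Proof. by apply: measurable_funD => //; exact: measurable_funM. Qed.

Lemma affine_preimage_oc a b c d : a != 0 -> c < d ->
  mu ((fun x : R => a * x + b) @^-1` `]c, d]) = (`|a|^-1 * (d - c))%:E.
Proof.
move=> a0 cd; have [agt0|alt0] : 0 < a \/ a < 0.
  by move: a0; rewrite neq_lt => /orP[]; [right|left].
- have -> : (fun x : R => a * x + b) @^-1` `]c, d]
      = `](c - b) / a, (d - b) / a]%classic.
    apply/seteqP; split=> x /=; rewrite !in_itv/= ltr_pdivrMr// ler_pdivlMr//
      [x * a]mulrC => /andP[? ?]; apply/andP; split; lra.
  rewrite lebesgue_measure_itv/= lte_fin ltr_pM2r ?invr_gt0// ltrD2r cd.
  by rewrite -EFinB gtr0_norm//; congr EFin; field.
- have -> : (fun x : R => a * x + b) @^-1` `]c, d]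
      = `[(d - b) / a, (c - b) / a[%classic.
    apply/seteqP; split=> x /=; rewrite !in_itv/= ltr_ndivlMr// ler_ndivrMr//
      [x * a]mulrC => /andP[? ?]; apply/andP; split; lra.
  rewrite lebesgue_measure_itv/= lte_fin ltr_nM2r ?invr_lt0// ltrD2r cd.
  by rewrite -EFinB ltr0_norm//; congr EFin; field.
Qed.

(** As functions of A both sides are measures; they agree on half-open intervals, so uniqueness of
    Lebesgue measure identifies them. *)
Lemma pushforward_affine a b (a0 : a != 0) (A : set R) : measurable A ->
  mu A = (`|a|%:E * mu ((fun x : R => a * x + b)%R @^-1` A))%E.
Proof.
have mab := measurable_affine a b.
pose mab_mixin := isMeasurableFun.Build _ _ (measurableTypeR R) (measurableTypeR R) _ mab.
pose phi : {mfun measurableTypeR R >-> measurableTypeR R} := HB.pack (fun x => a * x + b) mab_mixin.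
move=> mA.
rewrite (@lebesgue_measure_unique R
  (mscale (NngNum (normr_ge0 a)) (pushforward mu phi)) _ A mA)//.
move=> _ [[c d] _ <-]/=.
have [cd|dc] := ltP c d; last first.
  by rewrite set_itv_ge ?bnd_simp -?leNgt// measure0 measure0.
rewrite /mscale/= /pushforward/= affine_preimage_oc// lebesgue_measure_itv/=.
rewrite lte_fin cd -EFinB -EFinM; congr EFin.
by rewrite mulrA divff ?mul1r// normr_eq0.
Qed.

Lemma ge0_integral_affine a b (f : R -> \bar R) : a != 0 ->
  measurable_fun setT f -> (forall x, 0 <= f x)%E ->
  (\int[mu]_x f (a * x + b)%R = (`|a|^-1)%:E * \int[mu]_x f x)%E.
Proof.
move=> a0 mf f0.
have mab := measurable_affine a b.
pose mab_mixin := isMeasurableFun.Build _ _ (measurableTypeR R) (measurableTypeR R) _ mab.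
pose phi : {mfun measurableTypeR R >-> measurableTypeR R} := HB.pack (fun x => a * x + b) mab_mixin.
rewrite [in RHS](@eq_measure_integral _ _ _ _
  (mscale (NngNum (normr_ge0 a)) (pushforward mu phi))); last first.
  by move=> A mA _; exact: (@pushforward_affine a b a0 A mA).
rewrite ge0_integral_mscale//= muleA -EFinM mulVf ?normr_eq0// mul1e.
by rewrite ge0_integral_pushforward// => x _.
Qed.

Lemma integrable_affine a b f : a != 0 -> mu.-integrable setT (EFin \o f) ->
  mu.-integrable setT (fun x => (f (a * x + b))%:E).
Proof.
move=> a0 /integrableP[mf foo]; apply/integrableP; split.
  by apply: (measurableT_comp mf); exact: measurable_affine.
rewrite (@ge0_integral_affine a b (fun x => `|(f x)%:E|%E) a0)//.
  by rewrite lte_mul_pinfty// lee_fin invr_ge0.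
exact: measurableT_comp.
Qed.

Lemma integral_affine a b f : a != 0 -> mu.-integrable setT (EFin \o f) ->
  (\int[mu]_x (f (a * x + b))%:E = (`|a|^-1)%:E * \int[mu]_x (f x)%:E)%E.
Proof.
move=> a0 fi; have /measurable_int mf := fi.
rewrite integralE [in RHS]integralE muleBr//; last first.
  apply: fin_num_adde_defl; rewrite fin_numN.
  exact: integral_fune_fin_num (integrable_funeneg _ fi).
rewrite -!(@ge0_integral_affine a b) //.
- by congr (_ - _)%E; apply: eq_integral => x _; rewrite ?funeposE ?funenegE.
- exact: measurable_funeneg.
- exact: measurable_funepos.
Qed.

Lemma Rintegral_affine a b f : a != 0 -> mu.-integrable setT (EFin \o f) ->
  \int[mu]_x f (a * x + b) = `|a|^-1 * \int[mu]_x f x.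
Proof.
move=> a0 fi; rewrite /Rintegral integral_affine// fineM//.
exact: integrable_fin_num.
Qed.

End change_of_variables.

(** * Fubini for real-valued integrals *)

Section Rintegral_fubini.
Context {R : realType}.
Notation mu := (@lebesgue_measure R).
Notation L1 g := (mu.-integrable setT (EFin \o g)).

Lemma bounded_integrableM (b g : R -> R) (M : R) :
  measurable_fun setT b -> (forall x, `|b x| <= M) -> L1 g ->
  L1 (fun x => b x * g x).
Proof.
move=> mb bM gi; have /measurable_int/measurable_EFinP mg := gi.
apply: (le_integrable measurableT _ _ (integrableZl measurableT `|M| gi)) => //=.
  by apply/measurable_EFinP; exact: measurable_funM.
move=> x _; rewrite lee_fin !normrM normr_id ler_wpM2r//.
exact: le_trans (bM x) (ler_norm _).
Qed.

Lemma ge0_integrable (g : R -> R) :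
  measurable_fun setT g -> (forall x, 0 <= g x) ->
  (\int[mu]_x (g x)%:E < +oo)%E -> L1 g.
Proof.
move=> mg g0 goo; apply/integrableP; split; first by apply/measurable_EFinP.
apply: le_lt_trans goo; apply: ge0_le_integral => //.
- by apply: measurableT_comp => //; apply/measurable_EFinP.
- by apply/measurable_EFinP.
- by move=> x _ /=; rewrite ger0_norm.
Qed.

Section swap.
Variable F : R -> R -> R.
Hypothesis mF : measurable_fun setT (fun z : R * R => F z.1 z.2).
Hypothesis Foo : (\int[mu]_x \int[mu]_y (`|F x y|)%:E < +oo)%E.

Let Fi : (mu \x mu)%E.-integrable setT (fun z : R * R => (F z.1 z.2)%:E).
Proof.
apply/integrable12ltyP; first exact/measurable_EFinP.
exact: Foo.
Qed.

Lemma measurable_Rintegral_fst : measurable_fun setT (fun x => \int[mu]_y F x y).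
Proof.
apply: (measurableT_comp (fine_measurable measurableT)).
exact: (measurable_fubini_F Fi).
Qed.

Lemma integrable_Rintegral_fst : L1 (fun x => \int[mu]_y F x y).
Proof.
apply: le_integrable (integrable_fubini_F Fi) => //.
  by apply/measurable_EFinP; exact: measurable_Rintegral_fst.
have fine_le (r : \bar R) : (`|fine r|%:E <= `|r|)%E.
  by case: r => [r||] //=; rewrite normr0 leey.
by move=> x _; exact: fine_le.
Qed.

Let integral_fine (G : R -> \bar R) : measurable_fun setT G ->
  {ae mu, forall x, G x \is a fin_num} ->
  (\int[mu]_x (fine (G x))%:E = \int[mu]_x G x)%E.
Proof.
move=> mG Gfin; apply: ae_eq_integral => //.
  apply/measurable_EFinP.
  exact: (measurableT_comp (fine_measurable measurableT)).
by apply: (@filterS _ _ (ae_filter_ringOfSetsType mu)) Gfin => x Gx _; rewrite fineK.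
Qed.

(** The inner integrals are finite only almost everywhere; [fine] alters them on a null set, which
    [integral_fine] absorbs before Fubini's theorem is applied. *)
Lemma Rintegral_swap :
  \int[mu]_x \int[mu]_y F x y = \int[mu]_y \int[mu]_x F x y.
Proof.
rewrite {1 3}/Rintegral integral_fine; last 2 first.
- exact: (measurable_fubini_F Fi).
- by apply: (@filterS _ _ (ae_filter_ringOfSetsType mu)) (ae_integrable1 Fi) => x;
  exact: integrable_fin_num.
rewrite integral_fine; last 2 first.
- exact: (measurable_fubini_G Fi).
- by apply: (@filterS _ _ (ae_filter_ringOfSetsType mu)) (ae_integrable2 Fi) => x;
  exact: integrable_fin_num.
by rewrite (Fubini Fi).
Qed.

End swap.
End Rintegral_fubini.

(** * The Poisson kernel *)

Section poisson.
Context {R : realType}.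
Notation mu := (@lebesgue_measure R).
Notation L1 g := (mu.-integrable setT (EFin \o g)).

(* 1 + cos is nonnegative, so the half-line FTC for nonnegative functions
   applies. *)
Lemma is_derive_damped_cos (d u x : R) : 0 < d ->
  is_derive x 1 (fun x => - (expR (- d * x) / d) +
    expR (- d * x) * (u * sin (u * x) - d * cos (u * x)) / (d ^+ 2 + u ^+ 2))
    (expR (- d * x) * (1 + cos (u * x))).
Proof.
move=> d0.
have du0 : d ^+ 2 + u ^+ 2 != 0 by rewrite gt_eqF// ltr_wpDr ?sqr_ge0// exprn_gt0.
have dl (a y : R) : is_derive y 1 ( *%R a) a.
  by have := @is_deriveZ R R R id a y 1 1 _; rewrite /GRing.scale/= mulr1; apply.
have de : is_derive x 1 (fun x => expR (- d * x)) (expR (- d * x) * - d).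
  exact: (@is_derive1_comp R expR ( *%R (- d))).
have ds : is_derive x 1 (fun x => sin (u * x)) (cos (u * x) * u).
  exact: (@is_derive1_comp R sin ( *%R u)).
have dc : is_derive x 1 (fun x => cos (u * x)) (- sin (u * x) * u).
  exact: (@is_derive1_comp R cos ( *%R u)).
have dA : is_derive x 1 (fun x => u * sin (u * x) - d * cos (u * x))
    (u * (cos (u * x) * u) - d * (- sin (u * x) * u)).
  apply: (is_derive_eq (is_deriveB (is_deriveM (is_derive_cst u x 1) ds)
    (is_deriveM (is_derive_cst d x 1) dc))).
  by rewrite /GRing.scale/= !mulr0 !addr0.
have dB := is_deriveM (is_deriveM de dA)
  (is_derive_cst (d ^+ 2 + u ^+ 2)^-1 x 1).
have dE := is_deriveN (is_deriveM de (is_derive_cst d^-1 x 1)).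
apply: (is_derive_eq (is_deriveD dE dB)).
rewrite /GRing.scale/= !mulr0 !add0r.
set X := (X in _ + _ * (_ + X * _)).
have -> : X = u * sin (u * x) - d * cos (u * x) by [].
rewrite {X} /cst.
by field; rewrite du0 gt_eqF.
Qed.

Lemma cvg_expRMNy (d : R) : 0 < d -> expR (- d * x) @[x --> +oo] --> (0 : R).
Proof.
move=> d0; suff dy : d * x @[x --> +oo] --> +oo.
  rewrite (_ : (fun x => _) = (fun y => expR (- y)) \o (fun x => d * x)).
    exact: cvg_comp dy (@cvgr_expR R).
  by apply/funext => x /=; rewrite mulNr.
by apply: gt0_cvgMry => //; exact: cvg_id.
Qed.

Lemma integral_damped_cos (d u : R) : 0 < d ->
  (\int[mu]_(x in `[0%R, +oo[) (expR (- d * x) * (1 + cos (u * x)))%:E =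
   (d^-1 + d / (d ^+ 2 + u ^+ 2))%:E)%E.
Proof.
move=> d0.
have du0 : d ^+ 2 + u ^+ 2 != 0 by rewrite gt_eqF// ltr_wpDr ?sqr_ge0// exprn_gt0.
pose F (x : R) : R := - (expR (- d * x) / d) +
    expR (- d * x) * (u * sin (u * x) - d * cos (u * x)) / (d ^+ 2 + u ^+ 2).
pose f (x : R) : R := expR (- d * x) * (1 + cos (u * x)).
have dF (x : R) : is_derive x 1 F (f x) by exact: is_derive_damped_cos.
have cF : continuous F.
  by move=> x; apply: differentiable_continuous; apply/derivable1_diffP.
rewrite (@ge0_continuous_FTC2y _ f F 0 0).
- rewrite /F !mulr0 expR0 sin0 cos0 !mulr0 sub0r mul1r -EFinD; congr EFin.
  by field; rewrite du0 gt_eqF.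
- by move=> x _; rewrite mulr_ge0 ?expR_ge0// -lerBlDl sub0r cos_geN1.
- apply: continuous_subspaceT => x.
  apply: cvgM; first apply: (continuous_comp _ (@continuous_expR R _)).
    by apply: cvgM; [exact: cvg_cst|exact: cvg_id].
  apply: cvgD; first exact: cvg_cst.
  apply: (continuous_comp _ (@continuous_cos R _)).
  by apply: cvgM; [exact: cvg_cst|exact: cvg_id].
(* The trigonometric factor in [F] is at most |u| + d in absolute value, so |F x| <= C e^{-d x} and
   F vanishes at infinity. *)
- pose C := d^-1 + (`|u| + d) / (d ^+ 2 + u ^+ 2).
  apply: (@squeeze_cvgr _ _ _ _ (fun x => - (C * expR (- d * x)))
    (fun x => C * expR (- d * x))).
  + apply: nearW => x; rewrite -ler_norml.
    rewrite /F [leRHS]mulrC.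
    have -> : - (expR (- d * x) / d) + expR (- d * x) *
      (u * sin (u * x) - d * cos (u * x)) / (d ^+ 2 + u ^+ 2) =
      expR (- d * x) * (- d^-1 + (u * sin (u * x) - d * cos (u * x)) /
        (d ^+ 2 + u ^+ 2)) by ring.
    rewrite normrM ger0_norm ?expR_ge0// ler_wpM2l ?expR_ge0//.
    rewrite (le_trans (ler_normD _ _))// normrN gtr0_norm ?invr_gt0// lerD2l.
    rewrite normrM [`|_ ^-1|]ger0_norm; last by rewrite invr_ge0 addr_ge0 ?sqr_ge0.
    rewrite ler_wpM2r ?invr_ge0 ?addr_ge0 ?sqr_ge0//.
    rewrite (le_trans (ler_normB _ _))// !normrM lerD//.
      by rewrite ler_piMr// ler_norml sin_geN1 sin_le1.
    by rewrite gtr0_norm// ler_piMr ?(ltW d0)// ler_norml cos_geN1 cos_le1.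
  + rewrite -oppr0 -(mulr0 C); apply: cvgN; apply: cvgM; first exact: cvg_cst.
    exact: cvg_expRMNy.
  + rewrite -(mulr0 C); apply: cvgM; first exact: cvg_cst.
    exact: cvg_expRMNy.
- by move=> x _; exact: ex_derive.
- exact/cvg_at_right_filter/cF.
- by move=> x _; rewrite derive1E derive_val.
Qed.
End poisson.

(** * Fourier integral, scaling and total mass of the Poisson kernel *)

Section poisson_kernel_theory.
Context {R : realType}.
Notation mu := (@lebesgue_measure R).
Notation L1 g := (mu.-integrable setT (EFin \o g)).

Lemma continuous_damped_cos (d u : R) :
  continuous (fun t : R => expR (- d * `|t|) * (1 + cos (u * t))).
Proof.
move=> x; apply: cvgM.
  apply: (@continuous_comp _ _ _ (fun t : R => - d * `|t|) expR).
    by apply: cvgM; [exact: cvg_cst|exact: norm_continuous].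
  exact: continuous_expR.
apply: cvgD; first exact: cvg_cst.
apply: (continuous_comp _ (@continuous_cos R _)).
by apply: cvgM; [exact: cvg_cst|exact: cvg_id].
Qed.

Lemma integralT_damped_cos (d u : R) : 0 < d ->
  (\int[mu]_t (expR (- d * `|t|) * (1 + cos (u * t)))%:E =
   (2 * (d^-1 + d / (d ^+ 2 + u ^+ 2)))%:E)%E.
Proof.
move=> d0; rewrite ge0_symfun_integralT.
- rewrite EFinM -integral_damped_cos// set_itvcy; congr (_ * _)%E.
  by apply: eq_integral => x; rewrite inE/= => x0; rewrite ger0_norm.
- by move=> x; rewrite mulr_ge0 ?expR_ge0// -lerBlDl sub0r cos_geN1.
- exact: continuous_damped_cos.
- by move=> x /=; rewrite normrN mulrN cosN.
Qed.

(** For u = 0 the nonnegative integrand of [integralT_damped_cos] is twice this function. *)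
Lemma integrable_damped (d : R) : 0 < d -> L1 (fun t => expR (- d * `|t|)).
Proof.
move=> d0; have h : L1 (fun t : R => expR (- d * `|t|) * (1 + cos (0 * t))).
  apply: ge0_integrable.
  - by apply: continuous_measurable_fun; exact: continuous_damped_cos.
  - by move=> x; rewrite mul0r cos0 mulr_ge0 ?expR_ge0.
  - by rewrite integralT_damped_cos// ltry.
apply: eq_integrable (integrableZl measurableT 2^-1 h) => // x _ /=.
by rewrite -EFinM mul0r cos0; congr EFin; field.
Qed.

Lemma measurable_cosM (u : R) : measurable_fun setT (fun t : R => cos (u * t)).
Proof.
apply: continuous_measurable_fun => x.
apply: (continuous_comp _ (@continuous_cos R _)).
by apply: cvgM; [exact: cvg_cst|exact: cvg_id].
Qed.

Lemma measurable_sinM (u : R) : measurable_fun setT (fun t : R => sin (u * t)).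
Proof.
apply: continuous_measurable_fun => x.
apply: (continuous_comp _ (@continuous_sin R _)).
by apply: cvgM; [exact: cvg_cst|exact: cvg_id].
Qed.

Lemma norm_cos_le1 (x : R) : `|cos x| <= 1.
Proof. by rewrite ler_norml cos_geN1 cos_le1. Qed.

Lemma norm_sin_le1 (x : R) : `|sin x| <= 1.
Proof. by rewrite ler_norml sin_geN1 sin_le1. Qed.

Definition poisson_kernel (d u : R) : R := 2 * d / (d ^+ 2 + u ^+ 2).

(** The 1 in 1 + cos served only positivity; its contribution 2 / d, read off from the case u = 0,
    is subtracted here. *)
Lemma poisson_cos (d u : R) : 0 < d ->
  \int[mu]_t (cos (u * t) * expR (- d * `|t|)) = poisson_kernel d u.
Proof.
move=> d0; have i1 := integrable_damped d0.
have i2 : L1 (fun t => cos (u * t) * expR (- d * `|t|)).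
  apply: (@bounded_integrableM _ _ _ 1) => //; first exact: measurable_cosM.
  by move=> x; exact: norm_cos_le1.
have e v : \int[mu]_t (expR (- d * `|t|) * (1 + cos (v * t))) =
    2 * (d^-1 + d / (d ^+ 2 + v ^+ 2)).
  by rewrite /Rintegral integralT_damped_cos.
have e0 : \int[mu]_t (expR (- d * `|t|)) = 2 / d.
  have := e 0; under eq_Rintegral do rewrite mul0r cos0.
  rewrite RintegralZr// => h; apply: (@mulIf _ 2) => //.
  by rewrite h; field; rewrite gt_eqF.
have := e u; under eq_Rintegral do rewrite mulrDr mulr1 [_ * cos _]mulrC.
rewrite RintegralD// e0 => h.
apply: (addrI (2 / d)); rewrite h /poisson_kernel; field.
have -> : d ^+ 2 + u ^+ 2 != 0 by rewrite gt_eqF// ltr_wpDr ?sqr_ge0// exprn_gt0.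
by rewrite gt_eqF.
Qed.

Lemma poisson_ge0 (d u : R) : 0 <= d -> 0 <= poisson_kernel d u.
Proof. by move=> d0; rewrite /poisson_kernel divr_ge0 ?mulr_ge0// addr_ge0 ?sqr_ge0. Qed.

Lemma poisson_le (d u : R) : 0 < d -> poisson_kernel d u <= 2 / d.
Proof.
move=> d0; have du0 : 0 < d ^+ 2 + u ^+ 2 by rewrite ltr_wpDr ?sqr_ge0// exprn_gt0.
rewrite /poisson_kernel ler_pdivrMr// mulrAC ler_pdivlMr// -mulrA ler_wpM2l//.
by rewrite -expr2 lerDl sqr_ge0.
Qed.

Lemma continuous_poisson (d : R) : 0 < d -> continuous (poisson_kernel d).
Proof.
move=> d0 x; apply: cvgM; first exact: cvg_cst.
apply: cvgV; first by rewrite gt_eqF// ltr_wpDr ?sqr_ge0// exprn_gt0.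
by apply: cvgD; [exact: cvg_cst|exact: exprn_continuous].
Qed.

Lemma poisson_scale (d u : R) : 0 < d -> poisson_kernel d (d * u) = d^-1 * poisson_kernel 1 u.
Proof.
move=> d0; have n1 : 1 + u ^+ 2 != 0 by rewrite gt_eqF// ltr_wpDr ?sqr_ge0.
rewrite /poisson_kernel exprMn -[X in _ / (X + _)]mulr1 -mulrDr expr1n mulr1.
by field; rewrite n1 gt_eqF.
Qed.

(** Only positivity and finiteness matter. The antiderivative 2 atan is increasing and bounded by
    pi, so its limit exists as a supremum, which is left unevaluated. *)
Lemma poisson_mass : exists2 c : R, 0 < c &
  (\int[mu]_u (poisson_kernel 1 u)%:E = c%:E)%E.
Proof.
have dA (x : R) : is_derive x 1 (fun x => 2 * atan x) (poisson_kernel 1 x).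
  have := is_deriveZ 2 (is_derive1_atan x).
  by rewrite /poisson_kernel mulr1 expr1n.
have nd : {homo (fun x : R => 2 * atan x) : x y / x <= y}.
  by move=> x y xy; rewrite ler_wpM2l// le_atan.
have bd : has_ubound (range (fun x : R => 2 * atan x)).
  by exists pi => _ [x _ <-]; rewrite mulrC -ler_pdivlMr// ltW// atan_ltpi2.
have := nondecreasing_cvgr nd bd; set l := sup _ => cl.
have l0 : 0 < l.
  rewrite (@lt_le_trans _ _ (2 * atan 1))// ?atan1 ?mulr_gt0 ?divr_gt0 ?pi_gt0//.
  by rewrite -atan1; apply: sup_ubound => //; exists 1.
exists (2 * l); first by rewrite mulr_gt0.
rewrite ge0_symfun_integralT.
- rewrite EFinM -set_itvcy (@ge0_continuous_FTC2y _ _ (fun x => 2 * atan x) 0 l)//.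
  + by rewrite atan0 mulr0 sube0.
  + by move=> x _; exact: poisson_ge0.
  + by apply: continuous_subspaceT; exact: continuous_poisson.
  + apply: cvg_at_right_filter; apply: cvgM; first exact: cvg_cst.
    exact: continuous_atan.
  + by move=> x _; rewrite derive1E derive_val.
- by move=> x; exact: poisson_ge0.
- exact: continuous_poisson.
- by move=> x; rewrite /poisson_kernel/= sqrrN.
Qed.

End poisson_kernel_theory.

(** * Convolution and Fourier transform *)

Section convolution_theory.
Context {R : realType}.
Notation mu := (@lebesgue_measure R).
Notation L1 g := (mu.-integrable setT (EFin \o g)).
Implicit Types (b f g k : R -> R) (d t x y : R).

Lemma ft_reE g t : ft_re g t = \int[mu]_x (cos (t * x) * g x).
Proof. by []. Qed.

Lemma ft_imE g t : ft_im g t = \int[mu]_x (sin (t * x) * g x).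
Proof. by []. Qed.

Lemma integrable_cosM g t : L1 g -> L1 (fun x => cos (t * x) * g x).
Proof.
apply: (@bounded_integrableM _ _ _ 1); first exact: measurable_cosM.
by move=> x; exact: norm_cos_le1.
Qed.

Lemma integrable_sinM g t : L1 g -> L1 (fun x => sin (t * x) * g x).
Proof.
apply: (@bounded_integrableM _ _ _ 1); first exact: measurable_sinM.
by move=> x; exact: norm_sin_le1.
Qed.

Lemma norm_ft_re_le g t : L1 g -> `|ft_re g t| <= \int[mu]_x `|g x|.
Proof.
move=> gi; have ci := integrable_cosM t gi.
rewrite ft_reE (le_trans (le_normr_Rintegral _ ci))// le_Rintegral//.
- exact: integrable_norm ci.
- exact: integrable_norm gi.
- by move=> x _; rewrite normrM ler_piMl// norm_cos_le1.
Qed.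

Lemma norm_ft_im_le g t : L1 g -> `|ft_im g t| <= \int[mu]_x `|g x|.
Proof.
move=> gi; have ci := integrable_sinM t gi.
rewrite ft_imE (le_trans (le_normr_Rintegral _ ci))// le_Rintegral//.
- exact: integrable_norm ci.
- exact: integrable_norm gi.
- by move=> x _; rewrite normrM ler_piMl// norm_sin_le1.
Qed.

Lemma ft_abs2_ge0 g t : 0 <= ft_abs2 g t.
Proof. by rewrite /ft_abs2 addr_ge0 ?sqr_ge0. Qed.

(** The factor 2 comes from bounding the real and imaginary parts separately; this crude form is
    enough for rates. *)
Lemma ft_abs2_le g t : L1 g -> ft_abs2 g t <= 2 * (\int[mu]_x `|g x|) ^+ 2.
Proof.
move=> gi; rewrite /ft_abs2 mulr_natl mulr2n.
have n0 : 0 <= \int[mu]_x `|g x| by exact: Rintegral_ge0.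
by rewrite lerD// -[_ ^+ 2]real_normK ?num_real// ler_sqr ?nnegrE//;
  [exact: norm_ft_re_le|exact: norm_ft_im_le].
Qed.

Definition convolution k g x : R := \int[mu]_y (k (x - y) * g y).

Lemma measurable_convolution_kernel b k g : measurable_fun setT b ->
  measurable_fun setT k -> measurable_fun setT g ->
  measurable_fun setT (fun z : R * R => b z.1 * (k (z.1 - z.2) * g z.2)).
Proof.
move=> mb mk mg; apply: measurable_funM; first exact: measurableT_comp mb _.
apply: measurable_funM; last exact: measurableT_comp mg _.
by apply: (measurableT_comp mk); exact: measurable_funB.
Qed.

Section convolution_integrable.
Variables (k g : R -> R) (M : R).
Hypothesis ki : L1 k.
Hypothesis kM : forall x, `|k x| <= M.
Hypothesis gi : L1 g.

Let mk : measurable_fun setT k.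
Proof. by move/measurable_int/measurable_EFinP : ki. Qed.
Let mg : measurable_fun setT g.
Proof. by move/measurable_int/measurable_EFinP : gi. Qed.

(** By Tonelli the integral over x may be done first; translation invariance bounds it by B |g y|
    times the L1 norm of k. The bounded weight [b] is 1 for integrability of the convolution and a
    sine or cosine for its transform. *)
Lemma convolution_kernel_integrable b B : measurable_fun setT b ->
  (forall x, `|b x| <= B) ->
  (\int[mu]_x \int[mu]_y (`|b x * (k (x - y) * g y)|)%:E < +oo)%E.
Proof.
move=> mb bB; have mF := measurable_convolution_kernel mb mk mg.
pose F (z : R * R) : \bar R := (`|b z.1 * (k (z.1 - z.2) * g z.2)|)%:E.
have mF' : measurable_fun setT F by apply/measurable_EFinP; exact: measurableT_comp.
have B0 : 0 <= B by exact: le_trans (bB 0).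
have F0 z : (0 <= F z)%E by rewrite lee_fin normr_ge0.
have := @fubini_tonelli _ _ _ _ _ mu mu F mF'.
rewrite /F/= => -> //.
pose N := \int[mu]_x `|k x|.
have NE : (\int[mu]_x (`|k x|)%:E = N%:E)%E.
  by rewrite /N /Rintegral fineK//; exact: integrable_fin_num (integrable_norm ki).
have N0 : 0 <= N by exact: Rintegral_ge0.
apply: (@le_lt_trans _ _ (\int[mu]_y ((B * N)%:E * (`|g y|)%:E))%E).
  apply: ge0_le_integral => //.
  - by move=> y _; exact: integral_ge0.
  - exact: (@measurable_fun_fubini_tonelli_G _ _ _ _ _ mu F mF' F0).
  - by apply: measurable_funeM; apply/measurable_EFinP; exact: measurableT_comp.
  - move=> y _.
    apply: (@le_trans _ _ (\int[mu]_x ((B * `|g y|)%:E * (`|k (1 * x + - y)|)%:E))%E).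
      apply: ge0_le_integral => //.
      + apply/measurable_EFinP; apply: measurableT_comp => //.
        apply: measurable_funM => //; apply: measurable_funM => //.
        by apply: (measurableT_comp mk); exact: measurable_funB.
      + apply: measurable_funeM; apply/measurable_EFinP; apply: measurableT_comp => //.
        by apply: (measurableT_comp mk); exact: measurable_affine.
      + move=> x _; rewrite -EFinM lee_fin !normrM mul1r.
        have -> : B * `|g y| * `|k (x - y)| = B * (`|k (x - y)| * `|g y|) by ring.
        by rewrite ler_wpM2r ?mulr_ge0.
    rewrite ge0_integralZl//; last first.
    + by rewrite lee_fin mulr_ge0.
    + apply/measurable_EFinP; apply: measurableT_comp => //.
      by apply: (measurableT_comp mk); exact: measurable_affine.
    rewrite (@ge0_integral_affine _ 1 (- y) (fun x => (`|k x|)%:E))//; last first.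
      by apply/measurable_EFinP; exact: measurableT_comp.
    by rewrite normr1 invr1 mul1e NE -!EFinM lee_fin mulrAC.
rewrite ge0_integralZl//; last first.
- by rewrite lee_fin mulr_ge0.
- by apply/measurable_EFinP; exact: measurableT_comp.
rewrite lte_mul_pinfty ?lee_fin ?mulr_ge0//.
by have /integrableP[] := gi.
Qed.

Lemma integrable_convolution_section x : L1 (fun y => k (x - y) * g y).
Proof.
apply: (@bounded_integrableM _ _ _ M) => //.
by apply: (measurableT_comp mk); exact: measurable_funB.
Qed.

Lemma norm_convolution_le x : `|convolution k g x| <= M * \int[mu]_y `|g y|.
Proof.
have si := integrable_convolution_section x.
rewrite (le_trans (le_normr_Rintegral _ si))//.
rewrite -RintegralZl//; last exact: integrable_norm gi.
apply: le_Rintegral => //.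
- exact: integrable_norm si.
- exact: (integrableZl measurableT M (integrable_norm gi)).
- by move=> y _; rewrite normrM ler_wpM2r.
Qed.

Lemma convolution_bM b x : \int[mu]_y (b x * (k (x - y) * g y)) = b x * convolution k g x.
Proof. by rewrite RintegralZl//; exact: integrable_convolution_section. Qed.

Lemma integrable_convolution : L1 (convolution k g).
Proof.
have one_le (x : R) : `|cst 1 x| <= 1 :> R by rewrite normr1.
have h := convolution_kernel_integrable (measurable_cst _) one_le.
have mF := @measurable_convolution_kernel (cst 1) _ _ (measurable_cst _) mk mg.
have {}h := integrable_Rintegral_fst mF h.
apply: eq_integrable h => // x _ /=.
by congr EFin; have := convolution_bM (cst 1) x; rewrite mul1r.
Qed.

(** Serves twice: with b a sine or cosine it yields the convolution theorem, with b = 1 the total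
    mass of a convolution. *)
Lemma Rintegral_convolution b B : measurable_fun setT b -> (forall x, `|b x| <= B) ->
  \int[mu]_x (b x * convolution k g x) = \int[mu]_y ((\int[mu]_x (b x * k (x - y))) * g y).
Proof.
move=> mb bB; have mF := measurable_convolution_kernel mb mk mg.
have swap := Rintegral_swap mF (convolution_kernel_integrable mb bB).
rewrite (@eq_Rintegral _ _ _ mu _ (fun x => \int[mu]_y (b x * (k (x - y) * g y)))); last first.
  by move=> x _; rewrite convolution_bM.
transitivity (\int[mu]_y \int[mu]_x (b x * (k (x - y) * g y))); first exact: swap.
apply: eq_Rintegral => y _; rewrite -RintegralZr//; last first.
  apply: (@bounded_integrableM _ _ _ B) => //.
  have := integrable_affine (- y) (oner_neq0 R) ki.
  by apply: eq_integrable => // x _ /=; rewrite mul1r.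
by apply: eq_Rintegral => x _; rewrite mulrA.
Qed.

Lemma Rintegral_cos_shift t y : \int[mu]_x (cos (t * x) * k (x - y)) =
  cos (t * y) * ft_re k t - sin (t * y) * ft_im k t.
Proof.
have ci := integrable_cosM t ki; have si := integrable_sinM t ki.
pose G z : R := cos (t * y) * (cos (t * z) * k z) - sin (t * y) * (sin (t * z) * k z).
have ci' := integrableZl measurableT (cos (t * y)) ci.
have si' := integrableZl measurableT (sin (t * y)) si.
have Gi : L1 G by exact: integrableB ci' si'.
rewrite (@eq_Rintegral _ _ _ mu _ (fun x => G (1 * x + - y))); last first.
  move=> x _; rewrite /G mul1r !mulrA -mulrBl -cosD.
  by congr (cos _ * _); ring.
by rewrite (Rintegral_affine _ _ Gi) ?oner_neq0// normr1 invr1 mul1r RintegralB// !RintegralZl.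
Qed.

Lemma Rintegral_sin_shift t y : \int[mu]_x (sin (t * x) * k (x - y)) =
  sin (t * y) * ft_re k t + cos (t * y) * ft_im k t.
Proof.
have ci := integrable_cosM t ki; have si := integrable_sinM t ki.
pose G z : R := sin (t * y) * (cos (t * z) * k z) + cos (t * y) * (sin (t * z) * k z).
have ci' := integrableZl measurableT (sin (t * y)) ci.
have si' := integrableZl measurableT (cos (t * y)) si.
have Gi : L1 G by exact: integrableD ci' si'.
rewrite (@eq_Rintegral _ _ _ mu _ (fun x => G (1 * x + - y))); last first.
  move=> x _; rewrite /G mul1r !mulrA -mulrDl -sinD.
  by congr (sin _ * _); ring.
by rewrite (Rintegral_affine _ _ Gi) ?oner_neq0// normr1 invr1 mul1r RintegralD// !RintegralZl.
Qed.

Lemma ft_re_convolution t :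
  ft_re (convolution k g) t = ft_re k t * ft_re g t - ft_im k t * ft_im g t.
Proof.
rewrite ft_reE (@Rintegral_convolution _ 1); last 2 first.
- exact: measurable_cosM.
- by move=> x; exact: norm_cos_le1.
have ci := integrable_cosM t gi; have si := integrable_sinM t gi.
have ci' := integrableZl measurableT (ft_re k t) ci.
have si' := integrableZl measurableT (ft_im k t) si.
under eq_Rintegral do rewrite Rintegral_cos_shift mulrBl
  ![_ * ft_re k t]mulrC ![_ * ft_im k t]mulrC -!mulrA.
by rewrite RintegralB// !RintegralZl.
Qed.

Lemma ft_im_convolution t :
  ft_im (convolution k g) t = ft_re k t * ft_im g t + ft_im k t * ft_re g t.
Proof.
rewrite ft_imE (@Rintegral_convolution _ 1); last 2 first.
- exact: measurable_sinM.
- by move=> x; exact: norm_sin_le1.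
have ci := integrable_cosM t gi; have si := integrable_sinM t gi.
have ci' := integrableZl measurableT (ft_im k t) ci.
have si' := integrableZl measurableT (ft_re k t) si.
under eq_Rintegral do rewrite Rintegral_sin_shift mulrDl
  ![_ * ft_re k t]mulrC ![_ * ft_im k t]mulrC -!mulrA.
by rewrite RintegralD// !RintegralZl.
Qed.

Lemma ft_abs2_convolution t : ft_abs2 (convolution k g) t = ft_abs2 k t * ft_abs2 g t.
Proof. by rewrite /ft_abs2 ft_re_convolution ft_im_convolution; ring. Qed.

(** The factor is |k^(t) - 1|^2 in real coordinates; it vanishes exactly at the frequencies that
    smoothing by k leaves unchanged, which is how flatness of the kernel's transform enters the
    bias. *)
Lemma ft_abs2_convolutionB t : ft_abs2 (fun x => convolution k g x - g x) t =
  ((ft_re k t - 1) ^+ 2 + ft_im k t ^+ 2) * ft_abs2 g t.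
Proof.
have re : ft_re (fun x => convolution k g x - g x) t = ft_re (convolution k g) t - ft_re g t.
  rewrite !ft_reE -RintegralB//;
    [|exact: integrable_cosM integrable_convolution|exact: integrable_cosM].
  by apply: eq_Rintegral => x _; rewrite mulrBr.
have im : ft_im (fun x => convolution k g x - g x) t = ft_im (convolution k g) t - ft_im g t.
  rewrite !ft_imE -RintegralB//;
    [|exact: integrable_sinM integrable_convolution|exact: integrable_sinM].
  by apply: eq_Rintegral => x _; rewrite mulrBr.
by rewrite /ft_abs2 re im ft_re_convolution ft_im_convolution; ring.
Qed.

End convolution_integrable.
End convolution_theory.

(** * Damped Fourier energy *)

Section energy.
Context {R : realType}.
Notation mu := (@lebesgue_measure R).
Notation L1 g := (mu.-integrable setT (EFin \o g)).
Implicit Types (f g k u v : R -> R) (d t x y : R).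

(** * Bilinear integrals of two integrable functions against a bounded kernel *)

Section product_kernel.
Variables (u v : R -> R) (b : R -> R -> R) (B : R).
Hypotheses (ui : L1 u) (vi : L1 v).
Hypothesis mb : measurable_fun setT (fun z : R * R => b z.1 z.2).
Hypothesis bB : forall x y, `|b x y| <= B.

Let mu_ : measurable_fun setT u.
Proof. by move/measurable_int/measurable_EFinP : ui. Qed.
Let mv : measurable_fun setT v.
Proof. by move/measurable_int/measurable_EFinP : vi. Qed.

Let mbx x : measurable_fun setT (b x).
Proof. exact: (measurableT_comp mb (pair1_measurable x)). Qed.

Let mby y : measurable_fun setT (b ^~ y).
Proof. exact: (measurableT_comp mb (pair2_measurable y)). Qed.

Lemma measurable_product_kernel :
  measurable_fun setT (fun z : R * R => u z.1 * (b z.1 z.2 * v z.2)).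
Proof.
apply: measurable_funM; first exact: measurableT_comp mu_ _.
by apply: measurable_funM => //; exact: measurableT_comp mv _.
Qed.

Lemma product_kernel_integrable :
  (\int[mu]_x \int[mu]_y (`|u x * (b x y * v y)|)%:E < +oo)%E.
Proof.
pose N := \int[mu]_y `|v y|.
have NE : (\int[mu]_x (`|v x|)%:E = N%:E)%E.
  by rewrite /N /Rintegral fineK//; exact: integrable_fin_num (integrable_norm vi).
have N0 : 0 <= N by exact: Rintegral_ge0.
have B0 : 0 <= B by exact: le_trans (bB 0 0).
pose F (z : R * R) : \bar R := (`|u z.1 * (b z.1 z.2 * v z.2)|)%:E.
have mF : measurable_fun setT F.
  by apply/measurable_EFinP; apply: measurableT_comp => //; exact: measurable_product_kernel.
have F0 z : (0 <= F z)%E by rewrite lee_fin normr_ge0.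
apply: (@le_lt_trans _ _ (\int[mu]_x ((B * N)%:E * (`|u x|)%:E))%E).
  apply: ge0_le_integral => //.
  - by move=> y _; exact: integral_ge0.
  - exact: (@measurable_fun_fubini_tonelli_F _ _ _ _ _ mu F mF F0).
  - by apply: measurable_funeM; apply/measurable_EFinP; exact: measurableT_comp.
  - move=> x _.
    apply: (@le_trans _ _ (\int[mu]_y ((`|u x| * B)%:E * (`|v y|)%:E))%E).
      apply: ge0_le_integral => //.
      + apply/measurable_EFinP; apply: measurableT_comp => //.
        apply: measurable_funM; first exact: measurable_cst.
        by apply: measurable_funM; [exact: mbx|exact: mv].
      + by apply: measurable_funeM; apply/measurable_EFinP; apply: measurableT_comp.
      + move=> y _; rewrite -EFinM lee_fin !normrM -mulrA.
        by rewrite ler_wpM2l// ler_wpM2r.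
    rewrite ge0_integralZl//; last first.
    + by rewrite lee_fin mulr_ge0.
    + by apply/measurable_EFinP; apply: measurableT_comp.
    by rewrite NE -!EFinM lee_fin -mulrA mulrC.
rewrite ge0_integralZl//; last first.
- by rewrite lee_fin mulr_ge0.
- by apply/measurable_EFinP; exact: measurableT_comp.
rewrite lte_mul_pinfty ?lee_fin ?mulr_ge0//.
by have /integrableP[] := ui.
Qed.

Lemma measurable_kernel_transform :
  measurable_fun setT (fun x => u x * \int[mu]_y (b x y * v y)).
Proof.
have := measurable_Rintegral_fst measurable_product_kernel product_kernel_integrable.
apply: eq_measurable_fun => x _ /=; rewrite RintegralZl//.
exact: bounded_integrableM vi.
Qed.

Lemma kernel_swap : \int[mu]_x (u x * \int[mu]_y (b x y * v y)) =
  \int[mu]_y ((\int[mu]_x (b x y * u x)) * v y).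
Proof.
have swap := Rintegral_swap measurable_product_kernel product_kernel_integrable.
transitivity (\int[mu]_x \int[mu]_y (u x * (b x y * v y))).
  apply: eq_Rintegral => x _; rewrite RintegralZl//.
  exact: bounded_integrableM vi.
rewrite [LHS]swap; apply: eq_Rintegral => y _; rewrite -RintegralZr//.
  by apply: eq_Rintegral => x _; rewrite mulrCA mulrA.
exact: bounded_integrableM ui.
Qed.

End product_kernel.

Lemma measurable_cos_prod :
  measurable_fun setT (fun z : R * R => cos (z.1 * z.2)).
Proof.
have mc : measurable_fun setT (@cos R).
  by apply: continuous_measurable_fun; exact: continuous_cos.
by apply: (measurableT_comp mc); exact: measurable_funM.
Qed.

Lemma measurable_sin_prod :
  measurable_fun setT (fun z : R * R => sin (z.1 * z.2)).
Proof.
have ms : measurable_fun setT (@sin R).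
  by apply: continuous_measurable_fun; exact: continuous_sin.
by apply: (measurableT_comp ms); exact: measurable_funM.
Qed.

(* Fubini needs integrability in t as well, hence the factor e^{-|t|}. *)
Let measurable_undamp f : measurable_fun setT (fun t => expR (- 1 * `|t|) * f t) ->
  measurable_fun setT f.
Proof.
move=> mf; have me : measurable_fun setT (fun t : R => expR (`|t|)).
  by apply: measurableT_comp => //; exact: measurable_expR.
apply: eq_measurable_fun (measurable_funM me mf) => t _ /=.
by rewrite mulrA -expRD mulN1r addrN expR0 mul1r.
Qed.

Lemma measurable_ft_re g : L1 g -> measurable_fun setT (ft_re g).
Proof.
move=> gi; apply: measurable_undamp.
apply: (@measurable_kernel_transform _ _ (fun t x => cos (t * x)) 1) => //.
- exact: integrable_damped.
- exact: measurable_cos_prod.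
- by move=> *; exact: norm_cos_le1.
Qed.

Lemma measurable_ft_im g : L1 g -> measurable_fun setT (ft_im g).
Proof.
move=> gi; apply: measurable_undamp.
apply: (@measurable_kernel_transform _ _ (fun t x => sin (t * x)) 1) => //.
- exact: integrable_damped.
- exact: measurable_sin_prod.
- by move=> *; exact: norm_sin_le1.
Qed.

Lemma measurable_ft_abs2 g : L1 g -> measurable_fun setT (ft_abs2 g).
Proof.
move=> gi; apply: measurable_funD; apply: measurable_funX.
  exact: measurable_ft_re.
exact: measurable_ft_im.
Qed.

(** Two exchanges of integrals: first t against x, with the integral over y hidden in the bounded
    factor [b], then t against y for fixed x. The remaining integral over t is [poisson_cos]. *)
Lemma damped_energy g d : 0 < d -> L1 g ->
  \int[mu]_t (expR (- d * `|t|) * ft_abs2 g t) =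
  \int[mu]_x (convolution (poisson_kernel d) g x * g x).
Proof.
move=> d0 gi; pose N := \int[mu]_x `|g x|.
have N0 : 0 <= N by exact: Rintegral_ge0.
have wi := integrable_damped d0.
(* This is the real part of e^{-itx} g^(t), so integrating it against g gives |g^(t)|^2. *)
pose b t x := cos (t * x) * ft_re g t + sin (t * x) * ft_im g t.
have E t x : b t x = \int[mu]_y (cos (t * (x - y)) * g y).
  have ci := integrable_cosM t gi; have si := integrable_sinM t gi.
  have ci' := integrableZl measurableT (cos (t * x)) ci.
  have si' := integrableZl measurableT (sin (t * x)) si.
  transitivity (\int[mu]_y (cos (t * x) * (cos (t * y) * g y) +
                           sin (t * x) * (sin (t * y) * g y))).
    by rewrite RintegralD// !RintegralZl.
  by apply: eq_Rintegral => y _; rewrite mulrBr cosB mulrDl !mulrA.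
have E2 t : ft_abs2 g t = \int[mu]_x (b t x * g x).
  have ci := integrable_cosM t gi; have si := integrable_sinM t gi.
  have ci' := integrableZl measurableT (ft_re g t) ci.
  have si' := integrableZl measurableT (ft_im g t) si.
  transitivity (\int[mu]_x (ft_re g t * (cos (t * x) * g x) +
                           ft_im g t * (sin (t * x) * g x))).
    by rewrite RintegralD// !RintegralZl.
  by apply: eq_Rintegral => y _; rewrite /b mulrDl; congr (_ + _); ring.
under eq_Rintegral do rewrite E2.
rewrite (@kernel_swap _ _ _ (N + N)) //; last 2 first.
- apply: measurable_funD; apply: measurable_funM.
  + exact: measurable_cos_prod.
  + by apply: measurableT_comp => //; exact: measurable_ft_re.
  + exact: measurable_sin_prod.
  + by apply: measurableT_comp => //; exact: measurable_ft_im.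
- move=> t x; rewrite (le_trans (ler_normD _ _))// !normrM lerD//.
    by rewrite -[leRHS]mul1r ler_pM//; [exact: norm_cos_le1|exact: norm_ft_re_le].
  by rewrite -[leRHS]mul1r ler_pM//; [exact: norm_sin_le1|exact: norm_ft_im_le].
apply: eq_Rintegral => x _; congr (_ * _).
transitivity (\int[mu]_t (expR (- d * `|t|) * \int[mu]_y (cos (t * (x - y)) * g y))).
  by apply: eq_Rintegral => t _; rewrite E mulrC.
rewrite (@kernel_swap _ _ (fun t y => cos (t * (x - y))) 1) //; last 2 first.
- have mc : measurable_fun setT (@cos R).
    by apply: continuous_measurable_fun; exact: continuous_cos.
  apply: (measurableT_comp mc); apply: measurable_funM => //.
  exact: measurable_funB.
- by move=> *; exact: norm_cos_le1.
apply: eq_Rintegral => y _; congr (_ * _).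
rewrite -poisson_cos//.
by apply: eq_Rintegral => t _; rewrite [t * _]mulrC.
Qed.

End energy.

(** * Plancherel inequalities *)

Section plancherel.
Context {R : realType}.
Notation mu := (@lebesgue_measure R).
Notation L1 g := (mu.-integrable setT (EFin \o g)).
Implicit Types (f g k u v : R -> R) (d t x y : R).

(** Convergence almost everywhere is what Lebesgue differentiation later supplies. The limit is
    replaced by the lower limit, which agrees with it off a null set and is measurable. *)
Lemma fatou_le (f_ : nat -> R -> R) f (C : \bar R) :
  (forall n, measurable_fun setT (f_ n)) -> measurable_fun setT f ->
  (forall n x, 0 <= f_ n x) ->
  {ae mu, forall x, f_ ^~ x @ \oo --> f x} ->
  (forall n, \int[mu]_x (f_ n x)%:E <= C)%E -> (\int[mu]_x (f x)%:E <= C)%E.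
Proof.
move=> mf_ mf f0 cf fC.
pose F n x := (f_ n x)%:E.
have mF n : measurable_fun setT (F n) by apply/measurable_EFinP.
pose h x := limn_einf (F ^~ x).
have mh : measurable_fun setT h.
  apply: (emeasurable_fun_cvg (fun n x => einfs (F ^~ x) n)).
    by move=> n; exact: measurable_fun_einfs.
  by move=> x _; rewrite /h limn_einf_lim; exact: is_cvg_einfs.
rewrite (@ae_eq_integral _ _ _ mu setT h)//; first last.
- apply: (@filterS _ _ (ae_filter_ringOfSetsType mu)) cf => x cfx _.
  have cFx : F ^~ x @ \oo --> (f x)%:E by apply: cvg_EFin => //; apply: nearW.
  rewrite /h is_cvg_limn_einfE; last by apply/cvg_ex; eexists; exact: cFx.
  by apply/esym/cvg_lim.
- by apply/measurable_EFinP.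
have Fge n x : setT x -> (0 <= F n x)%E by move=> _; rewrite lee_fin.
apply: (le_trans (fatou mu measurableT mF Fge)).
rewrite limn_einf_lim; apply: lime_le; first exact: is_cvg_einfs.
apply: nearW => n; apply: le_trans (fC n).
by apply: ereal_inf_lbound; exists n => //=.
Qed.

Lemma dominated_Rintegral (f_ : nat -> R -> R) f g :
  (forall n, measurable_fun setT (f_ n)) -> measurable_fun setT f -> L1 g ->
  (forall x, f_ ^~ x @ \oo --> f x) -> (forall n x, `|f_ n x| <= g x) ->
  (fun n => \int[mu]_x f_ n x) @ \oo --> \int[mu]_x f x.
Proof.
move=> mf_ mf gi cf fg.
have [] := @dominated_convergence _ _ _ mu setT measurableT
  (fun n x => (f_ n x)%:E) (EFin \o f) (EFin \o g).
- by move=> n; apply/measurable_EFinP; exact: mf_.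
- by apply/measurable_EFinP; exact: mf.
- apply: aeW => x _; by apply: cvg_EFin; [exact: nearW|exact: cf].
- exact: gi.
- by apply: aeW => x n _; rewrite lee_fin.
move=> fi _ cI; apply: fine_cvg; rewrite fineK//.
exact: integrable_fin_num fi.
Qed.

Lemma integrable_poisson_kernel d : 0 < d -> L1 (poisson_kernel d).
Proof.
move=> d0; have [c c0 cE] := @poisson_mass R.
have i1 : L1 (poisson_kernel 1).
  apply: ge0_integrable.
  - by apply: continuous_measurable_fun; exact: continuous_poisson.
  - by move=> x; exact: poisson_ge0.
  - by rewrite cE ltry.
have dV : d^-1 != 0 by rewrite invr_neq0// gt_eqF.
have := integrableZl measurableT d^-1 (integrable_affine 0 dV i1).
apply: eq_integrable => // x _ /=; rewrite -EFinM; congr EFin.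
by rewrite addr0 -poisson_scale// mulrA divff ?mul1r// gt_eqF.
Qed.

(** This is the constant 2 pi of Plancherel's identity; only its positivity is used. *)
Definition pmass : R := \int[mu]_u poisson_kernel 1 u.

Lemma pmass_gt0 : 0 < pmass.
Proof. by have [c c0 cE] := @poisson_mass R; rewrite /pmass /Rintegral cE. Qed.

Lemma Rintegral_poisson d x : 0 < d ->
  \int[mu]_y poisson_kernel d (x - y) = pmass.
Proof.
move=> d0; have Nd : - d != 0 by rewrite oppr_eq0 gt_eqF.
rewrite /pmass; have pi := integrable_poisson_kernel d0.
have N1 : - 1 != 0 :> R by rewrite oppr_eq0 oner_eq0.
transitivity (\int[mu]_y poisson_kernel d (-1 * y + x)).
  by apply: eq_Rintegral => y _; rewrite mulN1r addrC.
rewrite (Rintegral_affine _ N1 pi) normrN1 invr1 mul1r.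
have := Rintegral_affine 0 (lt0r_neq0 d0) pi.
rewrite gtr0_norm// => /(congr1 ( *%R d)); rewrite mulrA divff ?gt_eqF// mul1r => <-.
rewrite -RintegralZl//; last exact: integrable_affine (lt0r_neq0 d0) pi.
by apply: eq_Rintegral => u _; rewrite addr0 poisson_scale// mulrA divff ?mul1r// gt_eqF.
Qed.

Lemma damped_energy_finite g d : 0 < d -> L1 g ->
  (\int[mu]_t (expR (- d * `|t|) * ft_abs2 g t)%:E =
   (\int[mu]_x (convolution (poisson_kernel d) g x * g x))%:E)%E.
Proof.
move=> d0 gi; rewrite -damped_energy// /Rintegral fineK//.
apply: integrable_fin_num => //.
have := @bounded_integrableM _ (ft_abs2 g) _ (2 * (\int[mu]_x `|g x|) ^+ 2)
  (measurable_ft_abs2 gi) _ (integrable_damped d0).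
move=> h; apply: eq_integrable (h _) => // [x _ /=|t]; first by rewrite mulrC.
by rewrite ger0_norm ?ft_abs2_ge0//; exact: ft_abs2_le.
Qed.

Let dn (n : nat) : R := n.+1%:R^-1.
Let dn_gt0 n : 0 < dn n. Proof. by rewrite invr_gt0 ltr0n. Qed.
Let cvg_dn : dn @ \oo --> (0 : R).
Proof. exact: cvg_harmonic. Qed.

Let cvg_damp t : (fun n => expR (- dn n * `|t|)) @ \oo --> (1 : R).
Proof.
rewrite -expR0; apply: (@continuous_cvg _ R R _ _ _ expR); first exact: continuous_expR.
rewrite -(mul0r `|t|); apply: cvgM; last exact: cvg_cst.
by rewrite -oppr0; exact: cvgN.
Qed.

(** The two sides differ by half the integral over y of k (x - y) (g x - g y)^2. After integration
    over x, both terms on the right contribute the same multiple of the squared L2 norm. *)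
Lemma convolution_sqr_le k g x M : (forall y, 0 <= k y) -> L1 k ->
  (forall y, `|k y| <= M) -> L1 g -> L1 (fun y => g y ^+ 2) ->
  convolution k g x * g x <=
  2^-1 * (g x ^+ 2 * \int[mu]_y k (x - y)) +
  2^-1 * convolution k (fun y => g y ^+ 2) x.
Proof.
move=> k0 ki kM gi g2i.
have ky : L1 (fun y => k (x - y)).
  have N1 : - 1 != 0 :> R by rewrite oppr_eq0 oner_eq0.
  have := integrable_affine x N1 ki.
  by apply: eq_integrable => // y _ /=; rewrite mulN1r addrC.
have si := integrable_convolution_section ki kM gi x.
have s2i := integrable_convolution_section ki kM g2i x.
have a1 := integrableZl measurableT (g x ^+ 2) ky.
have a2 := integrableZl measurableT 2^-1 a1.
have a3 := integrableZl measurableT 2^-1 s2i.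
rewrite -!RintegralZl// -RintegralD// -RintegralZr//.
apply: le_Rintegral => //.
- have := integrableZl measurableT (g x) si.
  by apply: eq_integrable => // y _ /=; rewrite -EFinM mulrC.
- exact: integrableD a2 a3.
move=> y _; rewrite -subr_ge0.
have -> : 2^-1 * (g x ^+ 2 * k (x - y)) + 2^-1 * (k (x - y) * g y ^+ 2) -
  k (x - y) * g y * g x = 2^-1 * k (x - y) * (g x - g y) ^+ 2 by field.
by rewrite mulr_ge0 ?sqr_ge0 ?mulr_ge0 ?invr_ge0.
Qed.

Lemma integral_ft_abs2_le g : L1 g -> L1 (fun x => g x ^+ 2) ->
  (\int[mu]_t (ft_abs2 g t)%:E <= (pmass * \int[mu]_x g x ^+ 2)%:E)%E.
Proof.
move=> gi g2i.
apply: (@fatou_le (fun n t => expR (- dn n * `|t|) * ft_abs2 g t)).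
- move=> n; apply: measurable_funM; last exact: measurable_ft_abs2.
  by have /measurable_int/measurable_EFinP := integrable_damped (dn_gt0 n).
- exact: measurable_ft_abs2.
- by move=> n t; rewrite mulr_ge0 ?expR_ge0 ?ft_abs2_ge0.
- apply: aeW => t; rewrite -[X in _ --> X]mul1r; apply: cvgM; last exact: cvg_cst.
  exact: cvg_damp.
move=> n; rewrite damped_energy_finite// lee_fin.
have d0 := dn_gt0 n; have pi := integrable_poisson_kernel d0.
have pM y : `|poisson_kernel (dn n) y| <= 2 / dn n.
  by rewrite ger0_norm ?poisson_ge0 ?(ltW d0)//; exact: poisson_le.
have p0 y : 0 <= poisson_kernel (dn n) y by rewrite poisson_ge0// ltW.
have c2 := integrable_convolution pi pM g2i.
have a1 := integrableZl measurableT (2^-1 * pmass) g2i.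
have a2 := integrableZl measurableT 2^-1 c2.
have c1 : L1 (fun x => convolution (poisson_kernel (dn n)) g x * g x).
  apply: (bounded_integrableM _ _ gi) => [|x].
    by have /measurable_int/measurable_EFinP := integrable_convolution pi pM gi.
  exact: norm_convolution_le pi pM gi x.
apply: (@le_trans _ _ (\int[mu]_x (2^-1 * pmass * g x ^+ 2 +
    2^-1 * convolution (poisson_kernel (dn n)) (fun y => g y ^+ 2) x))).
  apply: le_Rintegral => //; first exact: integrableD a1 a2.
  move=> x _; rewrite (le_trans (convolution_sqr_le _ p0 pi pM gi g2i))//.
  by rewrite Rintegral_poisson// -mulrA [pmass * _]mulrC.
rewrite RintegralD// !RintegralZl//.
suff -> : \int[mu]_x convolution (poisson_kernel (dn n)) (fun y => g y ^+ 2) x =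
    pmass * \int[mu]_x g x ^+ 2 by rewrite -mulrA -mulrDl; lra.
have := @Rintegral_convolution _ _ _ _ pi pM g2i (cst 1) 1 (measurable_cst _).
move=> h; transitivity (\int[mu]_x
    (cst 1 x * convolution (poisson_kernel (dn n)) (fun y => g y ^+ 2) x)).
  by apply: eq_Rintegral => x _; rewrite mul1r.
rewrite h; last by move=> x; rewrite normr1.
rewrite -RintegralZl//; apply: eq_Rintegral => y _; congr (_ * _).
(* The mass was computed in the second variable; evenness of the Poisson kernel transfers it to the
   first. *)
rewrite -(Rintegral_poisson y d0); apply: eq_Rintegral => x _.
rewrite /cst/= mul1r /poisson_kernel.
by congr (_ / (_ + _)); ring.
Qed.

End plancherel.

(** * The L2 norm bounded by the Fourier energy *)

Section plancherel_lower.
Context {R : realType}.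
Notation mu := (@lebesgue_measure R).
Notation L1 g := (mu.-integrable setT (EFin \o g)).
Implicit Types (f g k u v : R -> R) (d s t x y : R).

Let dn (n : nat) : R := n.+1%:R^-1.
Let dn_gt0 n : 0 < dn n. Proof. by rewrite invr_gt0 ltr0n. Qed.
Let cvg_dn : dn @ \oo --> (0 : R).
Proof. exact: cvg_harmonic. Qed.

(** The substitution y = x - d z moves d from the kernel into the argument of g, so that a majorant
    independent of d exists. *)
Lemma convolution_poisson g d x : 0 < d -> L1 (fun y => poisson_kernel d (x - y) * g y) ->
  convolution (poisson_kernel d) g x =
  \int[mu]_z (poisson_kernel 1 z * g (- d * z + x)).
Proof.
move=> d0 ci; have Nd : - d != 0 by rewrite oppr_eq0 gt_eqF.
have h := Rintegral_affine x Nd ci.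
have hi := integrable_affine x Nd ci.
rewrite /convolution; move: h; rewrite normrN gtr0_norm// => /(congr1 ( *%R d)).
rewrite mulrA divff ?gt_eqF// mul1r => <-; rewrite -RintegralZl//.
apply: eq_Rintegral => z _.
have -> : x - (- d * z + x) = d * z by ring.
by rewrite poisson_scale// !mulrA divff ?mul1r// gt_eqF.
Qed.

(** Dominated convergence is used twice as d tends to 0: at fixed x, with majorant M times the unit
    Poisson kernel, and then in x, with majorant pmass M |g|. Each damped energy is below the
    undamped one because e^{-d|t|} <= 1. *)
Lemma l2_le_ft_continuous g M : L1 g -> continuous g -> (forall x, `|g x| <= M) ->
  ((pmass * \int[mu]_x g x ^+ 2)%:E <= \int[mu]_t (ft_abs2 g t)%:E)%E.
Proof.
move=> gi cg gM; have p1 := @integrable_poisson_kernel R 1 ltr01.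
have mp : measurable_fun setT (@poisson_kernel R 1).
  by move/measurable_int/measurable_EFinP : p1.
have mg : measurable_fun setT g by exact: continuous_measurable_fun.
have M0 : 0 <= M by exact: le_trans (gM 0).
have ci d x : 0 < d -> L1 (fun y => poisson_kernel d (x - y) * g y).
  move=> d0; apply: (integrable_convolution_section (M := 2 / d)) => //.
  - exact: integrable_poisson_kernel.
  - by move=> z; rewrite ger0_norm ?poisson_ge0 ?(ltW d0)//; exact: poisson_le.
have mga d x : measurable_fun setT (fun z : R => g (d * z + x)).
  by apply: (measurableT_comp mg); exact: measurable_affine.
have pg_le d x z : `|poisson_kernel 1 z * g (d * z + x)| <= poisson_kernel 1 z * M.
  rewrite normrM ger0_norm; last by rewrite poisson_ge0.
  by rewrite ler_wpM2l// poisson_ge0.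
have pMi : L1 (fun z => poisson_kernel 1 z * M).
  have := integrableZl measurableT M p1.
  by apply: eq_integrable => // z _ /=; rewrite -EFinM mulrC.
have cvg_conv x : (fun n => convolution (poisson_kernel (dn n)) g x) @ \oo --> pmass * g x.
  rewrite (_ : (fun n => _) =
      (fun n => \int[mu]_z (poisson_kernel 1 z * g (- dn n * z + x)))); last first.
    by apply/funext => n; rewrite convolution_poisson//; exact: ci.
  rewrite /pmass -RintegralZr//.
  apply: (@dominated_Rintegral _ _ _ (fun z => poisson_kernel 1 z * M)) => //.
  - by move=> n; apply: measurable_funM; [exact: mp|exact: mga].
  - by apply: measurable_funM; [exact: mp|exact: measurable_cst].
  - move=> z; apply: cvgM; first exact: cvg_cst.
    apply: (@continuous_cvg _ R R _ _ _ g); first exact: cg.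
    rewrite -[X in _ --> X]add0r -(mul0r z).
    apply: cvgD; last exact: cvg_cst.
    apply: cvgM; last exact: cvg_cst.
    by rewrite -oppr0; exact: cvgN.
have conv_le n x : `|convolution (poisson_kernel (dn n)) g x| <= pmass * M.
  rewrite convolution_poisson//; last exact: ci.
  have i1 : L1 (fun z => poisson_kernel 1 z * g (- dn n * z + x)).
    apply: le_integrable pMi => //.
      by apply/measurable_EFinP; apply: measurable_funM; [exact: mp|exact: mga].
    move=> z _; rewrite lee_fin (le_trans (pg_le _ _ _))//.
    exact: ler_norm.
  rewrite (le_trans (le_normr_Rintegral _ i1))// /pmass -RintegralZr//.
  apply: le_Rintegral => //.
  exact: integrable_norm i1.
have mc n : measurable_fun setT (convolution (poisson_kernel (dn n)) g).
  have d0 := dn_gt0 n.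
  apply/measurable_EFinP; apply: (@measurable_int _ _ _ mu).
  apply: (integrable_convolution (M := 2 / dn n)) => //.
  - exact: integrable_poisson_kernel.
  - by move=> z; rewrite ger0_norm ?poisson_ge0 ?(ltW d0)//; exact: poisson_le.
have g2i : L1 (fun x => g x ^+ 2).
  by have := bounded_integrableM mg gM gi; apply: eq_integrable.
have cvgI : (fun n => \int[mu]_x (convolution (poisson_kernel (dn n)) g x * g x)) @ \oo -->
    pmass * \int[mu]_x g x ^+ 2.
  rewrite -RintegralZl//.
  apply: (@dominated_Rintegral _ _ _ (fun x => (pmass * M) * `|g x|)) => //.
  - by move=> n; apply: measurable_funM; [exact: mc|exact: mg].
  - by apply: measurable_funM; [exact: measurable_cst|exact: measurable_funX].
  - exact: (integrableZl measurableT (pmass * M) (integrable_norm gi)).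
  - by move=> x; rewrite expr2 mulrA; apply: cvgM; [exact: cvg_conv|exact: cvg_cst].
  - by move=> n x; rewrite normrM ler_wpM2r.
have cvgE : (fun n => (\int[mu]_x (convolution (poisson_kernel (dn n)) g x * g x))%:E) @ \oo
    --> (pmass * \int[mu]_x g x ^+ 2)%:E.
  by apply: cvg_EFin; [exact: nearW|exact: cvgI].
rewrite -(cvg_lim _ cvgE)//; apply: lime_le; first by apply/cvg_ex; eexists; exact: cvgE.
apply: nearW => n; rewrite -damped_energy_finite//.
apply: ge0_le_integral => //.
- by move=> t _; rewrite lee_fin mulr_ge0 ?expR_ge0 ?ft_abs2_ge0.
- apply/measurable_EFinP; apply: measurable_funM; last exact: measurable_ft_abs2.
  by have /measurable_int/measurable_EFinP := integrable_damped (dn_gt0 n).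
- by apply/measurable_EFinP; exact: measurable_ft_abs2.
- move=> t _; rewrite lee_fin ler_piMl ?ft_abs2_ge0// -expR0 ler_expR.
  by rewrite mulNr oppr_le0 mulr_ge0// ltW.
Qed.

(** The mass lies to the left of 0 so that convolution averages forwards, over ]x, x + s], the
    interval spanned by a forward difference of step s. *)
Definition box s x : R := s^-1 * \1_(`[- s, 0[%classic) x.

Lemma box_ge0 s x : 0 < s -> 0 <= box s x.
Proof. by move=> s0; rewrite /box mulr_ge0 ?invr_ge0 ?(ltW s0). Qed.

Lemma box_le s x : 0 < s -> `|box s x| <= s^-1.
Proof.
move=> s0; rewrite ger0_norm ?box_ge0// /box ler_piMr ?invr_ge0 ?(ltW s0)//.
Qed.

Lemma integral_box s : 0 < s -> (\int[mu]_x (box s x)%:E = 1)%E.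
Proof.
move=> s0; rewrite /box.
under eq_integral do rewrite EFinM.
rewrite ge0_integralZl//; last 2 first.
- by apply/measurable_EFinP; exact: measurable_indic.
- by rewrite lee_fin invr_ge0 ltW.
have mE : mu `[(- s), 0[%classic = s%:E.
  by rewrite lebesgue_measure_itv/= lte_fin oppr_lt0 s0 -EFinB sub0r opprK.
rewrite integral_indic// setIT; transitivity ((s^-1)%:E * s%:E)%E.
  by congr (_ * _)%E; exact: mE.
by rewrite -EFinM mulVf// gt_eqF.
Qed.

Lemma measurable_box s : measurable_fun setT (box s).
Proof. by apply: measurable_funM => //; exact: measurable_indic. Qed.

Lemma integrable_box s : 0 < s -> L1 (box s).
Proof.
move=> s0; apply: ge0_integrable.
- exact: measurable_box.
- by move=> x; exact: box_ge0.
- by rewrite integral_box// ltry.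
Qed.

(** The sharp bound is 1; the loss in [ft_abs2_le] reappears as the 2 of [l2_le_ft] and the 2^j of
    [ft_abs2_iter_box]. *)
Lemma ft_abs2_box s t : 0 < s -> ft_abs2 (box s) t <= 2.
Proof.
move=> s0; rewrite (le_trans (ft_abs2_le _ (integrable_box s0)))//.
suff -> : \int[mu]_x `|box s x| = 1 by rewrite expr1n mulr1.
transitivity (\int[mu]_x box s x); last by rewrite /Rintegral integral_box.
by apply: eq_Rintegral => x _; rewrite ger0_norm// box_ge0.
Qed.

Lemma convolution_box s g x : 0 < s -> L1 g ->
  convolution (box s) g x = s^-1 * \int[mu]_(y in `]x, (x + s)]) g y.
Proof.
move=> s0 gi; have mI : measurable `]x, (x + s)]%classic by exact: measurable_itv.
have giD : L1 (g \_ `]x, (x + s)]).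
  have m1 : measurable_fun setT (\1_(`]x, (x + s)]%classic) : R -> R).
    exact: measurable_indic.
  have b1 y : `|\1_(`]x, (x + s)]%classic) y| <= 1 :> R.
    by rewrite indicE; case: (_ \in _); rewrite ?normr1 ?normr0.
  apply: eq_integrable (bounded_integrableM m1 b1 gi) => // y _ /=.
  by rewrite indicE patchE; case: ifP => _; rewrite ?mul1r ?mul0r.
rewrite Rintegral_mkcond -RintegralZl//.
apply: eq_Rintegral => y _; rewrite /box indicE patchE -mulrA; congr (_ * _).
have -> : ((x - y)%R \in `[- s, 0[%classic) = (y \in `]x, (x + s)]%classic).
  by apply/idP/idP; rewrite !inE/= !in_itv/= => /andP[? ?]; apply/andP; split; lra.
by case: ifP => _; rewrite ?mul1r ?mul0r.
Qed.

Lemma integrable_convolution_box s g : 0 < s -> L1 g -> L1 (convolution (box s) g).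
Proof.
move=> s0 gi; apply: integrable_convolution gi; first exact: integrable_box.
by move=> x; exact: box_le.
Qed.

(** Near x0 the average is s^-1 (F (x + s) - F x) for an indefinite integral F based at a. The
    compact interval [a, b] has x0 and x0 + s in its interior, and F is continuous there. *)
Lemma continuous_convolution_box s g : 0 < s -> L1 g ->
  continuous (convolution (box s) g).
Proof.
move=> s0 gi x0; pose a := x0 - 1; pose b := x0 + s + 1.
pose F x := \int[mu]_(y in `[a, x]) g y.
have giab : mu.-integrable `[a, b] (EFin \o g) by exact: integrableS gi.
have ab : a < b by rewrite /a /b; lra.
have cF := @parameterized_integral_continuous _ a b g (ltW ab) giab.
have cFx x : a < x < b -> {for x, continuous F}.
  by move=> xab; apply: (within_continuous_continuous ab cF); rewrite in_itv.
have E x : a < x < x0 + 1 -> convolution (box s) g x = s^-1 * (F (x + s) - F x).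
  move=> /andP[ax xx]; rewrite convolution_box//; congr (_ * _).
  rewrite Rintegral_itvB//.
  - by apply: integrableS gi.
  - by rewrite bnd_simp ltW.
  - by rewrite bnd_simp lerDl ltW.
rewrite /continuous_at E; last by rewrite /a; lra.
have E' : {near x0, (fun x => s^-1 * (F (x + s) - F x)) =1 convolution (box s) g}.
  near=> x; rewrite E//; apply/andP; split; near: x.
    by apply: lt_nbhsr; rewrite /a; lra.
  by apply: lt_nbhsl; lra.
apply: cvg_trans (near_eq_cvg E') _.
apply: cvgM; first exact: cvg_cst.
apply: cvgB; last by apply: cFx; rewrite /a /b; lra.
apply: (@continuous_comp _ _ _ (fun x => x + s) F).
  by apply: cvgD; [exact: cvg_id|exact: cvg_cst].
by apply: cFx; rewrite /a /b; lra.
Unshelve. all: by end_near. Qed.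

Lemma ae_cvg_convolution_box g : L1 g ->
  {ae mu, forall x, (fun n => convolution (box (dn n)) g x) @ \oo --> g x}.
Proof.
move=> gi; have gl : locally_integrable setT g by exact: (open_integrable_locally openT gi).
have mE n x : mu `]x, (x + dn n)] = (dn n)%:E.
  by rewrite lebesgue_measure_itv/= lte_fin ltrDl dn_gt0 -EFinB addrAC subrr add0r.
have nE x : nicely_shrinking x (fun n => `]x, (x + dn n)]%classic).
  split=> //.
  have r0 n : 0 < 2 * dn n by rewrite mulr_gt0.
  (* The ball of radius 2 [dn n] contains the interval and has measure 4 [dn n], four times that of
     the interval. *)
  exists (4, fun n => PosNum (r0 n)); split => //=.
  - by rewrite -(mulr0 2); apply: cvgM; [exact: cvg_cst|exact: cvg_dn].
  - move=> n y /=; rewrite in_itv/= => /andP[xy yx]; have := dn_gt0 n.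
    by rewrite /ball/= ltr_distlC; lra.
  - by move=> n; rewrite lebesgue_measure_ball ?(ltW (r0 n))// mE -EFinM lee_fin; lra.
apply: (@filterS _ _ (ae_filter_ringOfSetsType mu)) (lebesgue_differentiation gl) => x gx.
have := nice_lebesgue_differentiation nE gl gx.
move=> /fine_cvg; apply: cvg_trans; apply: near_eq_cvg; apply: nearW => n /=.
rewrite convolution_box// mE.
have gD : mu.-integrable `]x, (x + dn n)] (EFin \o g) by exact: integrableS gi.
by rewrite inver gt_eqF// fineM//; exact: integrable_fin_num gD.
Qed.

(** Stated in the extended reals for g merely in L1: square integrability is a consequence when the
    right-hand side is finite. The averages [gn n] satisfy the continuous case, and their energies
    exceed that of g by at most the factor 2 of [ft_abs2_box]. *)
Lemma l2_le_ft g : L1 g ->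
  ((pmass%:E * \int[mu]_x (g x ^+ 2)%:E)%E <= 2%:E * \int[mu]_t (ft_abs2 g t)%:E)%E.
Proof.
move=> gi; have mg : measurable_fun setT g.
  by move/measurable_int/measurable_EFinP : gi.
have p0 := @pmass_gt0 R.
pose gn n := convolution (box (dn n)) g.
have gni n : L1 (gn n) by exact: integrable_convolution_box.
have gnM n x : `|gn n x| <= (dn n)^-1 * \int[mu]_y `|g y|.
  apply: (norm_convolution_le (integrable_box (dn_gt0 n))) gi _ => y.
  exact: box_le.
have key n : (\int[mu]_x (gn n x ^+ 2)%:E <=
    (pmass^-1)%:E * (2%:E * \int[mu]_t (ft_abs2 g t)%:E))%E.
  have := l2_le_ft_continuous (gni n) (continuous_convolution_box (dn_gt0 n) gi) (gnM n).
  have g2i : L1 (fun x => gn n x ^+ 2).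
    have mgn : measurable_fun setT (gn n) by move/measurable_int/measurable_EFinP : (gni n).
    by have := bounded_integrableM mgn (gnM n) (gni n); apply: eq_integrable.
  have g2E : ((\int[mu]_x gn n x ^+ 2)%:E = \int[mu]_x (gn n x ^+ 2)%:E)%E.
    by rewrite /Rintegral fineK//; exact: integrable_fin_num g2i.
  rewrite lee_pdivlMl// EFinM g2E.
  move=> /le_trans; apply.
  rewrite -ge0_integralZl//; last 2 first.
  - by apply/measurable_EFinP; exact: measurable_ft_abs2.
  - by move=> t _; rewrite lee_fin ft_abs2_ge0.
  apply: ge0_le_integral => //.
  - by move=> t _; rewrite lee_fin ft_abs2_ge0.
  - by apply/measurable_EFinP; exact: measurable_ft_abs2.
  - by apply: measurable_funeM; apply/measurable_EFinP; exact: measurable_ft_abs2.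
  - move=> t _; rewrite -EFinM lee_fin /gn.
    rewrite (ft_abs2_convolution (integrable_box (dn_gt0 n)) (fun y => box_le y (dn_gt0 n)) gi).
    by rewrite ler_wpM2r ?ft_abs2_ge0// ft_abs2_box.
rewrite -lee_pdivlMl//.
apply: (@fatou_le _ (fun n x => gn n x ^+ 2)) => //.
- move=> n; apply: measurable_funX.
  by move/measurable_int/measurable_EFinP : (gni n).
- exact: measurable_funX.
- by move=> n x; exact: sqr_ge0.
apply: (@filterS _ _ (ae_filter_ringOfSetsType mu)) (ae_cvg_convolution_box gi) => x gx.
by rewrite expr2; apply: cvgM.
Qed.

End plancherel_lower.

(** * Fundamental theorem of calculus for everywhere differentiable functions *)

Section everywhere_derivative.
Context {R : realType}.
Notation mu := (@lebesgue_measure R).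
Notation L1 g := (mu.-integrable setT (EFin \o g)).
Implicit Types (f g F G K : R -> R) (a b x y : R).

(** Let c be the supremum of the points of [a, b] up to which the inequality holds. Continuity of K
    and monotonicity of G show that it holds at c; the local hypothesis would then carry it past c
    unless c = b. *)
Lemma local_growth_le G K a b : a <= b -> {homo G : x y / x <= y} ->
  continuous K ->
  (forall x, a <= x < b -> \forall y \near x^'+, K y - K x <= G y - G x) ->
  K b - K a <= G b - G a.
Proof.
move=> ab ndG cK loc.
pose S := [set x | [/\ a <= x, x <= b & K x - K a <= G x - G a]].
have Sa : S a by split => //; rewrite !subrr.
have ubS : ubound S b by move=> x [].
have supS : has_sup S by split; [exists a|exists b].
pose c := sup S.
have ac : a <= c by apply: sup_upper_bound.
have cb : c <= b by apply: ge_sup => //; exists a.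
have Sc : K c - K a <= G c - G a.
  rewrite leNgt; apply/negP => h.
  (* A point z of [S] close to c on the left has K z near K c, while G z <= G c; continuity of G is
     not at stake, because its jumps go in the favourable direction. *)
  have e0 : 0 < (K c - K a) - (G c - G a) by rewrite subr_gt0.
  have /cvgrPdist_lt/(_ _ e0)/nbhs_ballP[d /= d0 dK] := cK c.
  have [z [az zb Kz] cz] := sup_adherent d0 supS.
  have zc : z <= c by apply: sup_upper_bound.
  have := dK z; rewrite /ball/= ltr_distlC => /(_ _).
  have zd : c - d < z < c + d by move: cz; rewrite -/c => cz; apply/andP; split; lra.
  move=> /(_ zd); rewrite ltr_distlC => /andP[h1 h2].
  by have := ndG _ _ zc; lra.
have [<-//|cneb] := eqVneq c b.
have cltb : c < b by rewrite lt_neqAle cneb.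
have locc := loc c; rewrite ac cltb/= in locc.
have : \forall y \near c^'+, [/\ c < y, y <= b & K y - K c <= G y - G c].
  near=> y; split.
  - by near: y; exact: nbhs_right_gt.
  - by near: y; exact: nbhs_right_le.
  - by near: y; exact: locc.
move=> /filter_ex[y [cy yb Ky]].
have : y <= c.
  apply: sup_upper_bound => //; split => //; first by rewrite (le_trans ac)// ltW.
  by lra.
by rewrite leNgt cy.
Unshelve. all: by end_near. Qed.

Section positive_part.
Variables (K : R -> R) (a b : R).
Hypothesis ab : a < b.
Hypothesis dK : forall x, derivable K x 1.
Hypothesis mK : measurable_fun setT (derive1 K).
Let phi x := Num.max ((derive1 K) x) 0.
Hypothesis phi_oo : (\int[mu]_(x in `[a, b]) (phi x)%:E < +oo)%E.

Let D : set R := `[a, b]%classic.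
Let mD : measurable D. Proof. exact: measurable_itv. Qed.
Let muD : mu D = (b - a)%:E.
Proof. by rewrite /D lebesgue_measure_itv/= lte_fin ab -EFinB. Qed.

Let phi0 x : 0 <= phi x. Proof. by rewrite /phi le_max lexx orbT. Qed.

Let mphi : measurable_fun setT phi.
Proof. by apply: measurable_maxr => //; exact: measurable_cst. Qed.

(* phi + e is dominated, up to a small error in integral, by a lower
   semicontinuous function g: the slice E n = {n e <= phi < (n + 1) e} is enlarged
   to an open U n on which the value (n + 1) e is used.  The indefinite integral
   of g grows locally at least as fast as K, because K' < (n + 1) e <= g near a
   point of E n. *)
Section cover.
Variable e : R.
Hypothesis e0 : 0 < e.

Let E n : set R := D `&` [set x | n%:R * e <= phi x < n.+1%:R * e].

Let mE n : measurable (E n).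
Proof.
apply: measurableI => //.
rewrite (_ : [set x | _] = phi @^-1` `[n%:R * e, n.+1%:R * e[%classic); last first.
  by apply/seteqP; split => x /=; rewrite in_itv.
by rewrite -[X in measurable X]setTI; apply: mphi => //; exact: measurable_itv.
Qed.

Let trivE : trivIset setT E.
Proof.
apply/trivIsetP => i j _ _ ij; apply/seteqP; split => // x [[_ /andP[i1 i2]] [_ /andP[j1 j2]]].
move: ij; rewrite neq_lt => /orP[] ij.
- have : i.+1%:R * e <= j%:R * e by rewrite ler_pM2r// ler_nat.
  by move=> /(lt_le_trans i2)/lt_le_trans/(_ j1); rewrite ltxx.
- have : j.+1%:R * e <= i%:R * e by rewrite ler_pM2r// ler_nat.
  by move=> /(lt_le_trans j2)/lt_le_trans/(_ i1); rewrite ltxx.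
Qed.

(** Chosen so that the value (n + 1) e on the excess set U n minus E n costs at most e / 2^(n+1),
    which sums to e. *)
Let eta n : R := (n.+1%:R * e)^-1 * (e / (2 ^ n.+1)%:R).
Let eta0 n : 0 < eta n.
Proof. by rewrite /eta mulr_gt0 ?invr_gt0 ?mulr_gt0 ?invr_gt0// ltr0n expn_gt0. Qed.

Let open_cover n : exists U : set R, [/\ open U, E n `<=` U & (mu (U `\` E n) < (eta n)%:E)%E].
Proof.
apply: lebesgue_regularity_outer => //.
apply: (@le_lt_trans _ _ (mu D)); last by rewrite muD ltry.
by apply: le_measure; [rewrite inE; exact: mE|rewrite inE; exact: mD|exact: subIsetl].
Qed.

Let U n : set R := sval (cid (open_cover n)).
Let openU n : open (U n). Proof. by rewrite /U; case: cid => ? []. Qed.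
Let EU n : E n `<=` U n. Proof. by rewrite /U; case: cid => ? []. Qed.
Let muUE n : (mu (U n `\` E n) < (eta n)%:E)%E. Proof. by rewrite /U; case: cid => ? []. Qed.
Let mU n : measurable (U n). Proof. exact: open_measurable. Qed.

Let g_ n x : \bar R := (n.+1%:R * e * \1_(U n) x)%:E.
Let g x : \bar R := (\sum_(n <oo) g_ n x)%E.

Let g_ge0 n x : (0 <= g_ n x)%E.
Proof. by rewrite lee_fin mulr_ge0// mulr_ge0// ltW. Qed.

Let mg_ n : measurable_fun setT (g_ n).
Proof.
apply/measurable_EFinP; apply: measurable_funM; first exact: measurable_cst.
exact: measurable_indic.
Qed.

Let g0 x : (0 <= g x)%E. Proof. exact: nneseries_ge0. Qed.

Let mg : measurable_fun setT g.
Proof. exact: ge0_emeasurable_sum. Qed.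

(** On E n the value (n + 1) e is at most phi + e, and the slices are disjoint subsets of D; this
    gives the first two terms. The last e is the geometric sum of the excesses. *)
Let integral_g : (\int[mu]_(x in D) g x <=
  \int[mu]_(x in D) (phi x)%:E + (e * (b - a))%:E + e%:E)%E.
Proof.
rewrite integral_nneseries//; last by move=> n; apply: measurable_funTS; exact: mg_.
apply: (@le_trans _ _ (\sum_(n <oo) (\int[mu]_(x in E n) (phi x + e)%:E +
    (e / (2 ^ n.+1)%:R)%:E))%E).
  apply: lee_nneseries => n _; first by move=> *; exact: integral_ge0.
  have c0 : (0 <= (n.+1%:R * e)%:E)%E by rewrite lee_fin mulr_ge0// ltW.
  have -> : (\int[mu]_(x in D) g_ n x = (n.+1%:R * e)%:E * mu (U n `&` D))%E.
    rewrite /g_; under eq_integral do rewrite EFinM.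
    rewrite ge0_integralZl//; last first.
      apply: measurable_funTS; apply/measurable_EFinP; exact: (measurable_indic (mU n)).
    by congr (_ * _)%E; apply: integral_indic; [exact: mD|exact: mU].
  have muU : (mu (U n `&` D) <= mu (E n) + (eta n)%:E)%E.
    apply: (@le_trans _ _ (mu (E n `|` (U n `\` E n)))).
      apply: le_measure; rewrite ?inE.
      - by apply: measurableI; [exact: mU|exact: mD].
      - by apply: measurableU; [exact: mE|apply: measurableD; [exact: mU|exact: mE]].
      - by move=> x [Ux _]; have [Ex|nEx] := pselect (E n x); [left|right].
    apply: (@le_trans _ _ (mu (E n) + mu (U n `\` E n))%E).
      apply: measureU2; first exact: mE.
      by apply: measurableD; [exact: mU|exact: mE].
    by rewrite leeD2l// ltW// muUE.
  apply: (le_trans (lee_wpmul2l c0 muU)).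
  rewrite ge0_muleDr ?lee_fin ?(ltW (eta0 n))// leeD//; last first.
    by rewrite -EFinM lee_fin /eta mulrA divff ?mul1r// mulf_neq0 ?pnatr_eq0// gt_eqF.
  rewrite -integral_cst//; last exact: mE.
  apply: ge0_le_integral => //.
  - exact: mE.
  - by apply: measurable_funTS; apply/measurable_EFinP; apply: measurable_funD;
    [exact: mphi|exact: measurable_cst].
  - move=> x [_ /andP[h _]] /=; rewrite lee_fin -natr1 mulrDl mul1r lerD2r//.
apply: (le_trans (epsilon_trick _ _ _)).
- by move=> n; apply: integral_ge0 => x _; rewrite lee_fin addr_ge0// ltW.
- exact: ltW.
rewrite leeD2r// -ge0_integral_bigcup//; first last.
- by move=> x _; rewrite lee_fin addr_ge0// ltW.
- by apply: measurable_funTS; apply/measurable_EFinP; apply: measurable_funD;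
    [exact: mphi|exact: measurable_cst].
rewrite (_ : (e * (b - a))%:E = \int[mu]_(x in D) e%:E)%E; last first.
  by rewrite integral_cst// EFinM; congr (_ * _)%E; exact/esym/muD.
rewrite -ge0_integralD//; last first.
- by move=> x _; rewrite lee_fin ltW.
- by apply: measurable_funTS; apply/measurable_EFinP; exact: mphi.
- by move=> x _; rewrite lee_fin; exact: phi0.
apply: ge0_subset_integral => //.
- by apply: bigcup_measurable => n _; exact: mE.
- by apply: measurable_funTS; apply/measurable_EFinP; apply: measurable_funD;
    [exact: mphi|exact: measurable_cst].
- by move=> x _; rewrite lee_fin addr_ge0// ltW.
- by apply: bigcup_sub => n _; exact: subIsetl.
Qed.

Let g_lty : (\int[mu]_(x in D) g x < +oo)%E.
Proof.
apply: (le_lt_trans integral_g); rewrite -addeA -EFinD.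
by apply: lte_add_pinfty; [exact: phi_oo|exact: ltry].
Qed.

(** Freezing the upper limit at b makes G finite and monotone on the whole line, as
    [local_growth_le] demands. *)
Let G y : R := fine (\int[mu]_(x in `]a, (Num.min y b)]) g x).

Let G_fin y : (\int[mu]_(x in `]a, (Num.min y b)]) g x)%E \is a fin_num.
Proof.
rewrite ge0_fin_numE; last exact: integral_ge0.
apply: le_lt_trans g_lty; apply: ge0_subset_integral => //.
  by apply: measurable_funTS; exact: mg.
by move=> x; rewrite /D/= !in_itv/= le_min => /andP[/ltW -> /andP[_ ->]].
Qed.

Let ndG : {homo G : x y / x <= y}.
Proof.
move=> x y xy; rewrite /G fine_le// ge0_subset_integral//.
  by apply: measurable_funTS; exact: mg.
move=> z /=; rewrite !in_itv/= => /andP[-> /=] zx; rewrite (le_trans zx)//.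
by rewrite le_min !ge_min xy lexx orbT.
Qed.

Let G_growth n x y : a <= x -> x <= y -> y <= b -> `]x, y] `<=` U n ->
  n.+1%:R * e * (y - x) <= G y - G x.
Proof.
move=> ax xy yb xyU; rewrite lerBrDl /G.
have xb : x <= b by exact: le_trans yb.
have := G_fin x; have := G_fin y; rewrite !min_l// => fy fx.
rewrite -lee_fin EFinD !fineK//.
rewrite (_ : `]a, y]%classic = `]a, x] `|` `]x, y]); last first.
  by rewrite -itv_bndbnd_setU// bnd_simp.
rewrite ge0_integral_setU//=; first last.
- apply/disj_setPS => z [/=]; rewrite !in_itv/= => /andP[_ zx] /andP[].
  by rewrite ltNge zx.
- by apply: measurable_funTS; exact: mg.
rewrite leeD2l//.
have -> : ((n.+1%:R * e * (y - x))%:E = \int[mu]_(z in `]x, y]) (n.+1%:R * e)%:E)%E.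
  rewrite integral_cst//=.
  rewrite EFinM; congr (_ * _)%E.
  rewrite lebesgue_measure_itv/= lte_fin; have [xy'|yx] := ltP x y; first by rewrite EFinB.
  by rewrite (_ : y = x) ?subrr//; apply/eqP; rewrite eq_le yx.
apply: ge0_le_integral => //.
- by move=> z _; rewrite lee_fin mulr_ge0// ltW.
- by apply: measurable_funTS; exact: mg.
move=> z /xyU Uz; rewrite /g.
have gge : (g_ n z <= \sum_(0 <= i < n.+1) g_ i z)%E.
  by rewrite big_nat_recr//= leeDr// sume_ge0.
apply: le_trans (nneseries_lim_ge n.+1 (P := xpredT) _); last by [].
apply: le_trans gge.
by rewrite /g_ indicE mem_set// mulr1.
Qed.

Lemma growth_cover : K b - K a <=
  fine (\int[mu]_(x in D) (phi x)%:E) + e * (b - a) + e.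
Proof.
have cK : continuous K.
  by move=> x; apply: differentiable_continuous; exact/derivable1_diffP.
apply: (@le_trans _ _ (G b - G a)).
  apply: local_growth_le => //; first exact: ltW.
  move=> x /andP[ax xb].
  pose n := Num.truncn (phi x / e).
  have /truncn_itv/andP[n1 n2] : 0 <= phi x / e by rewrite divr_ge0// ltW.
  rewrite -/n ler_pdivlMr// in n1; rewrite -/n ltr_pdivrMr// in n2.
  have Ux : U n x.
    by apply: EU; split; [rewrite /D/= in_itv/= ax ltW|apply/andP].
  have [r /= r0 rU] : exists2 r : R, 0 < r & ball x r `<=` U n.
    by apply/nbhs_ballP; apply: open_nbhs_nbhs; split => //; exact: openU.
  (* Since n is the integer part of phi x / e, this bound is strict, and strictness is what passes
     to the nearby difference quotients. *)
  have dlt : derive1 K x < n.+1%:R * e.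
    by apply: le_lt_trans n2; rewrite /phi le_max lexx.
  have quot : \forall h \near (0 : R)^', h^-1 * (K (h + x) - K x) < n.+1%:R * e.
    have /cvg_ex[l cl] : derivable K x 1 by exact: dK.
    have ll : l = derive1 K x.
      by rewrite derive1E; apply/esym/cvg_lim => //; exact: Rhausdorff.
    have cl' : (fun h : R => h^-1 * (K (h + x) - K x)) @ (0 : R)^' --> derive1 K x.
      rewrite -ll; move: cl; apply: cvg_trans; apply: near_eq_cvg; near=> h.
      by rewrite /GRing.scale/= mulr1.
    exact: (cvgr_lt _ cl' _ dlt).
  have := quot; rewrite near_withinE => /nbhs_ballP[d /= d0 dq].
  near=> y.
  have xy : x < y by near: y; exact: nbhs_right_gt.
  have yb : y <= b by near: y; exact: nbhs_right_le.
  have yr : y < x + r by near: y; apply: nbhs_right_lt; rewrite ltrDl.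
  have yd : y < x + d by near: y; apply: nbhs_right_lt; rewrite ltrDl.
  apply: le_trans (G_growth ax (ltW xy) yb _); last first.
    move=> z /=; rewrite in_itv/= => /andP[xz zy]; apply: rU.
    by rewrite /ball/= ltr_distlC; apply/andP; split; lra.
  have := dq (y - x); rewrite /ball/= sub0r normrN gtr0_norm ?subr_gt0//.
  rewrite subrK => /(_ _ _) h; rewrite -ler_pdivrMr ?subr_gt0// mulrC ltW//.
  by apply: h; [lra|rewrite subr_eq0 gt_eqF].
have -> : G a = 0.
  by rewrite /G min_l ?(ltW ab)// set_itv_ge ?bnd_simp ?ltxx// integral_set0.
rewrite subr0 -lee_fin /G fineK// minxx.
have pfin : (\int[mu]_(x in D) (phi x)%:E)%E \is a fin_num.
  by rewrite ge0_fin_numE//; apply: integral_ge0 => x _; rewrite lee_fin; exact: phi0.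
rewrite !EFinD fineK//; apply: le_trans integral_g.
apply: ge0_subset_integral => //.
  by apply: measurable_funTS; exact: mg.
by move=> x; rewrite /D/= !in_itv/= => /andP[/ltW -> ->].
Unshelve. all: by end_near. Qed.

End cover.

Lemma growth_le_positive_part : K b - K a <= \int[mu]_(x in D) phi x.
Proof.
apply/ler_addgt0Pr => e e0.
have ba : 0 < b - a + 1 by rewrite addr_gt0// subr_gt0.
(* With this value in place of e, the error e (b - a) + e of [growth_cover] becomes exactly e. *)
have e1 : 0 < e / (b - a + 1) by rewrite divr_gt0.
rewrite (le_trans (growth_cover e1))// /Rintegral -addrA lerD2l.
by rewrite -[X in _ + X]mulr1 -mulrDr divfK// gt_eqF.
Qed.

End positive_part.
(* The derivative is not bounded below, so growth_le_positive_part is applied to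
   F + n x and n is sent to infinity. *)
Lemma derivable_growth_le F a b : a < b -> (forall x, derivable F x 1) ->
  measurable_fun setT (derive1 F) ->
  mu.-integrable `[a, b] (EFin \o derive1 F) ->
  F b - F a <= \int[mu]_(x in `[a, b]) derive1 F x.
Proof.
move=> ab dF mF iF.
have mI : measurable (`[a, b]%classic : set (measurableTypeR R)).
  exact: measurable_itv.
have muD : mu (`[a, b]%classic : set R) = (b - a)%:E.
  by rewrite lebesgue_measure_itv/= lte_fin ab -EFinB.
pose K (n : nat) (x : R) : R := F x + n%:R * x.
have dl (n : nat) (y : R) : is_derive y 1 ( *%R (n%:R : R)) n%:R.
  by have := @is_deriveZ R R R id n%:R y 1 1 _; rewrite /GRing.scale/= mulr1; apply.
have isF (x : R) : is_derive x 1 F (derive1 F x).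
  by rewrite derive1E; apply: derivableP; exact: dF.
have isK n (x : R) : is_derive x 1 (K n) (derive1 F x + n%:R).
  exact: is_deriveD (isF x) (dl n x).
have dK n (x : R) : derivable (K n) x 1 by have [] := isK n x.
have K' n : derive1 (K n) = (fun x => derive1 F x + n%:R).
  by apply/funext => x; rewrite derive1E; apply: derive_val; exact: isK.
have mK n : measurable_fun setT (derive1 (K n)).
  by rewrite K'; apply: measurable_funD => //; exact: measurable_cst.
pose tr (n : nat) (x : R) : R := Num.max (derive1 F x) (- n%:R).
have trE n x : Num.max (derive1 (K n) x) 0 = tr n x + n%:R.
  by rewrite K' /tr addr_maxl addNr.
have mtr n : measurable_fun setT (tr n).
  by apply: measurable_maxr => //; exact: measurable_cst.
have tr_le n x : `|tr n x| <= `|derive1 F x|.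
  rewrite /tr; case: (leP (derive1 F x) (- n%:R)) => // h.
  rewrite normrN ger0_norm// ler0_norm; first by rewrite lerNr.
  by rewrite (le_trans h)// oppr_le0.
have itr n : mu.-integrable `[a, b] (EFin \o tr n).
  apply: le_integrable iF => //.
    by apply: measurable_funTS; apply/measurable_EFinP; exact: mtr.
  by move=> x _; rewrite lee_fin tr_le.
have icst n : mu.-integrable `[a, b] (EFin \o cst (n%:R : R)).
  apply/integrableP; split; first by apply/measurable_EFinP; exact: measurable_cst.
  rewrite (_ : (\int[mu]_(x in _) _)%E = (\int[mu]_(x in `[a, b]) (n%:R)%:E)%E); last first.
    by apply: eq_integral => x _ /=; rewrite normr_nat.
  rewrite integral_cst//= (_ : mu _ = (b - a)%:E); last exact: muD.
  by rewrite -EFinM ltry.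
(* The term n (b - a) appears on both sides, from n x in [K n] and from the shift of the truncated
   derivative, and cancels. *)
have le n : F b - F a <= \int[mu]_(x in `[a, b]) tr n x.
  have iD := integrableD mI (itr n) (icst n).
  have phi_oo : (\int[mu]_(x in `[a, b]) (Num.max (derive1 (K n) x) 0)%:E < +oo)%E.
    under eq_integral do rewrite trE.
    by rewrite ltey_eq; have := integrable_fin_num mI iD => /= ->.
  have := growth_le_positive_part ab (dK n) (mK n) phi_oo.
  under eq_Rintegral do rewrite trE.
  rewrite (RintegralD mI (itr n) (icst n)).
  have -> : \int[mu]_(x in `[a, b]) cst n%:R x = n%:R * (b - a).
    rewrite Rintegral_cst//; transitivity (n%:R * fine (b - a)%:E) => //.
    by congr (_ * fine _); exact: muD.
  by rewrite /K -lerBlDr; apply: le_trans; lra.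
have cvg_tr x : (fun n => tr n x) @ \oo --> derive1 F x.
  apply: cvg_near_cst; near=> n; rewrite /tr max_l// lerNl.
  rewrite (le_trans (ler_norm _))// normrN.
  by near: n; exact: nbhs_infty_ger.
have [] := @dominated_convergence _ _ _ mu `[a, b]%classic mI
  (fun n x => (tr n x)%:E) (EFin \o derive1 F) (fun x => (`|derive1 F x|)%:E).
- by move=> n; apply: measurable_funTS; apply/measurable_EFinP; exact: mtr.
- by apply: measurable_funTS; apply/measurable_EFinP; exact: mF.
- by apply: aeW => x _; apply: cvg_EFin; [exact: nearW|exact: cvg_tr].
- exact: integrable_norm iF.
- by apply: aeW => x n _ /=; rewrite lee_fin; exact: tr_le.
move=> _ _ cI.
have cR : (fun n => \int[mu]_(x in `[a, b]) tr n x) @ \oo -->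
    \int[mu]_(x in `[a, b]) derive1 F x.
  by apply: fine_cvg; rewrite fineK//; exact: integrable_fin_num iF.
rewrite -(cvg_lim _ cR)//; apply: limr_ge; first by apply/cvg_ex; eexists; exact: cR.
exact: nearW.
Unshelve. all: by end_near. Qed.

(** The one-sided estimate is applied to F and to -F. *)
Lemma derivable_ftc F a b : a < b -> (forall x, derivable F x 1) ->
  measurable_fun setT (derive1 F) ->
  mu.-integrable `[a, b] (EFin \o derive1 F) ->
  \int[mu]_(x in `]a, b]) derive1 F x = F b - F a.
Proof.
move=> ab dF mF iF.
rewrite Rintegral_itv_obnd_cbnd; last first.
  by apply: integrableS iF => // x /=; rewrite !in_itv/= => /andP[/ltW -> ->].
apply/eqP; rewrite eq_le derivable_growth_le// andbT.
have dN (x : R) : derivable (- F) x 1 by apply: derivableN; exact: dF.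
have N' : derive1 (- F) = (fun x => - derive1 F x).
  by apply/funext => x; rewrite !derive1E deriveN.
have mN : measurable_fun setT (derive1 (- F)).
  by rewrite N'; exact: measurable_funN.
have iN : mu.-integrable `[a, b] (EFin \o derive1 (- F)).
  by rewrite N'; exact: integrableN iF.
have := derivable_growth_le ab dN mN iN; rewrite N'.
have mI : measurable (`[a, b]%classic : set (measurableTypeR R)).
  exact: measurable_itv.
have -> : \int[mu]_(x in `[a, b]) - derive1 F x = - \int[mu]_(x in `[a, b]) derive1 F x.
  rewrite -mulN1r -RintegralZl//.
  by apply: eq_Rintegral => x _; rewrite mulN1r.
rewrite -[(- F) b]/(- F b) -[(- F) a]/(- F a); lra.
Qed.

End everywhere_derivative.

(** * Fourier decay from integrable derivatives *)

Section derivative_decay.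
Context {R : realType}.
Notation mu := (@lebesgue_measure R).
Notation L1 g := (mu.-integrable setT (EFin \o g)).
Implicit Types (f g F k : R -> R) (c s t x y : R).

Lemma integrable_scale c g : L1 g -> L1 (fun x => c * g x).
Proof. by move=> gi; have := integrableZl measurableT c gi; apply: eq_integrable. Qed.

Lemma ft_abs2_scale c g t : L1 g -> ft_abs2 (fun x => c * g x) t = c ^+ 2 * ft_abs2 g t.
Proof.
move=> gi; rewrite /ft_abs2 !ft_reE !ft_imE.
rewrite (_ : \int[mu]_x (cos (t * x) * (c * g x)) = c * \int[mu]_x (cos (t * x) * g x)); last first.
  rewrite -RintegralZl//; last exact: integrable_cosM.
  by apply: eq_Rintegral => x _; rewrite mulrCA.
rewrite (_ : \int[mu]_x (sin (t * x) * (c * g x)) = c * \int[mu]_x (sin (t * x) * g x)); last first.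
  rewrite -RintegralZl//; last exact: integrable_sinM.
  by apply: eq_Rintegral => x _; rewrite mulrCA.
by rewrite !exprMn mulrDr.
Qed.

Definition fdiff s g x : R := g (x + s) - g x.

Lemma integrable_translate s g : L1 g -> L1 (fun x => g (x + s)).
Proof.
move=> gi; have := integrable_affine s (oner_neq0 R) gi.
by apply: eq_integrable => // x _; rewrite mul1r.
Qed.

Lemma integrable_diff s g : L1 g -> L1 (fdiff s g).
Proof.
move=> gi; have := integrableB measurableT (integrable_translate s gi) gi.
by apply: eq_integrable.
Qed.

Lemma Rintegral_translate s g : L1 g -> \int[mu]_x g (x + s) = \int[mu]_x g x.
Proof.
move=> gi; have := Rintegral_affine s (oner_neq0 R) gi.
rewrite normr1 invr1 mul1r => <-.
by apply: eq_Rintegral => x _; rewrite mul1r.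
Qed.

(* With this step, cos (t * x) and sin (t * x) change sign under translation. *)
Lemma ft_abs2_diff g t : t != 0 -> L1 g ->
  ft_abs2 (fdiff (pi / `|t|) g) t = 4 * ft_abs2 g t.
Proof.
move=> t0 gi; set s := pi / `|t|.
have [cs ss] : cos (t * s) = -1 /\ sin (t * s) = 0.
  move: t0; rewrite /s neq_lt => /orP[tn|tp].
  - rewrite ltr0_norm// (_ : t * _ = - pi); last by field; rewrite lt_eqF.
    by rewrite cosN sinN cospi sinpi oppr0.
  - rewrite gtr0_norm// (_ : t * _ = pi); last by field; rewrite gt_eqF.
    by rewrite cospi sinpi.
have cE x : cos (t * x) = - cos (t * (x + s)) by rewrite mulrDr cosD cs ss; ring.
have sE x : sin (t * x) = - sin (t * (x + s)) by rewrite mulrDr sinD cs ss; ring.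
have ci := integrable_cosM t gi; have si := integrable_sinM t gi.
have re : ft_re (fdiff s g) t = - 2 * ft_re g t.
  rewrite !ft_reE.
  have -> : \int[mu]_x (cos (t * x) * fdiff s g x) =
      \int[mu]_x ((- 1) * (cos (t * (x + s)) * g (x + s)) - cos (t * x) * g x).
    by apply: eq_Rintegral => x _; rewrite /fdiff mulrBr {1}cE; ring.
  have ti := integrable_translate s ci.
  rewrite RintegralB//; last exact: integrable_scale ti.
  by rewrite RintegralZl// (Rintegral_translate _ ci); ring.
have im : ft_im (fdiff s g) t = - 2 * ft_im g t.
  rewrite !ft_imE.
  have -> : \int[mu]_x (sin (t * x) * fdiff s g x) =
      \int[mu]_x ((- 1) * (sin (t * (x + s)) * g (x + s)) - sin (t * x) * g x).
    by apply: eq_Rintegral => x _; rewrite /fdiff mulrBr {1}sE; ring.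
  have ti := integrable_translate s si.
  rewrite RintegralB//; last exact: integrable_scale ti.
  by rewrite RintegralZl// (Rintegral_translate _ si); ring.
by rewrite /ft_abs2 re im; ring.
Qed.

Lemma derivable_iter_diff s f j : (forall x, derivable f x 1) ->
  (forall x, derivable (iter j (fdiff s) f) x 1) /\
  derive1 (iter j (fdiff s) f) = iter j (fdiff s) (derive1 f).
Proof.
move=> df; elim: j => [//|j [dj Ej]].
have isF (x : R) : is_derive x 1 (iter j (fdiff s) f) (derive1 (iter j (fdiff s) f) x).
  by rewrite derive1E; apply: derivableP; exact: dj.
have isS (x : R) : is_derive x 1 (fdiff s (iter j (fdiff s) f))
    (fdiff s (derive1 (iter j (fdiff s) f)) x).
  have isT : is_derive x 1 (fun x => x + s) 1.
    by have := is_deriveD (is_derive_id x 1) (is_derive_cst s x 1); rewrite addr0.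
  have isFT := @is_derive1_comp _ (iter j (fdiff s) f) (fun x => x + s) _ _ _ (isF (x + s)) isT.
  by have := is_deriveB isFT (isF x); rewrite mulr1.
split; first by move=> x /=; have [] := isS x.
by apply/funext => x /=; rewrite -Ej derive1E; apply: derive_val; exact: isS.
Qed.

Lemma convolution_scale k g M c x : L1 k -> (forall y, `|k y| <= M) -> L1 g ->
  convolution k (fun y => c * g y) x = c * convolution k g x.
Proof.
move=> ki kM gi; rewrite /convolution -RintegralZl//.
  by apply: eq_Rintegral => y _; rewrite mulrCA.
exact: integrable_convolution_section kM gi x.
Qed.

Lemma integrable_iter_box s g j : 0 < s -> L1 g ->
  L1 (iter j (convolution (box s)) g).
Proof. by move=> s0 gi; elim: j => [//|j IH]; exact: integrable_convolution_box. Qed.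

(* The derivatives of order 0 < i < j need not be integrable, so f' itself may not
   be averaged: instead iter j (fdiff s) f is differentiable with derivative
   iter j (fdiff s) f', which is integrable by induction. *)
Lemma iter_diff_box s j f : 0 < s ->
  (forall i, (i < j)%N -> forall x, derivable (derive1n i f) x 1) ->
  L1 (derive1n j f) ->
  iter j (fdiff s) f =
  (fun x => s ^+ j * iter j (convolution (box s)) (derive1n j f) x).
Proof.
move=> s0; elim: j f => [|j IH] f df fi.
  by apply/funext => x /=; rewrite expr0 mul1r.
have E : derive1n j.+1 f = derive1n j (derive1 f) by rewrite /derive1n iterSr.
have df1 i : (i < j)%N -> forall x, derivable (derive1n i (derive1 f)) x 1.
  by move=> ij x; have := df i.+1 ij x; rewrite /derive1n iterSr.
have fi1 : L1 (derive1n j (derive1 f)) by rewrite -E.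
have {}IH := IH (derive1 f) df1 fi1.
have df0 (x : R) : derivable f x 1 by exact: (df 0%N).
have [dF F'] := derivable_iter_diff s j df0.
have ui := integrable_iter_box j s0 fi1.
have F'i : L1 (derive1 (iter j (fdiff s) f)).
  by rewrite F' IH; exact: integrable_scale.
apply/funext => x /=.
rewrite -E in IH ui *.
rewrite {1}/fdiff -(@derivable_ftc _ (iter j (fdiff s) f)) ?ltrDl//; last 2 first.
- by move/measurable_int/measurable_EFinP : F'i.
- exact: integrableS F'i.
have -> : \int[mu]_(y in `]x, (x + s)]) derive1 (iter j (fdiff s) f) y =
    s * convolution (box s) (derive1 (iter j (fdiff s) f)) x.
  by rewrite convolution_box// mulrA divff ?mul1r// gt_eqF.
rewrite F' IH (convolution_scale (M := s^-1) _ _ (integrable_box s0))//; last first.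
  by move=> y; exact: box_le.
by rewrite exprS mulrA.
Qed.

Lemma ft_abs2_iter_box s g j t : 0 < s -> L1 g ->
  ft_abs2 (iter j (convolution (box s)) g) t <= 2 ^+ j * ft_abs2 g t.
Proof.
move=> s0 gi; elim: j => [|j IH]; first by rewrite expr0 mul1r.
have ui := integrable_iter_box j s0 gi.
rewrite iterS (ft_abs2_convolution (integrable_box s0) (fun y => box_le y s0) ui).
by rewrite exprS -mulrA ler_pM ?ft_abs2_ge0// ft_abs2_box.
Qed.

(** The j differences contribute 4^j on the left; on the right stand s^(2j) from the scaling and 2^j
    from the j averages. The quotient is (s^2 / 2)^j. *)
Lemma ft_abs2_derive1n_le f j t : t != 0 -> L1 f ->
  (forall i, (i < j)%N -> forall x, derivable (derive1n i f) x 1) ->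
  L1 (derive1n j f) ->
  ft_abs2 f t <= ((pi / `|t|) ^+ 2 / 2) ^+ j * ft_abs2 (derive1n j f) t.
Proof.
move=> t0 fi df fji; set s := pi / `|t|.
have s0 : 0 < s by rewrite divr_gt0 ?pi_gt0// normr_gt0.
have h : ft_abs2 (iter j (fdiff s) f) t = 4 ^+ j * ft_abs2 f t.
  have gen i : L1 (iter i (fdiff s) f) /\ ft_abs2 (iter i (fdiff s) f) t = 4 ^+ i * ft_abs2 f t.
    elim: i => [|i [ii IH]]; first by split => //; rewrite expr0 mul1r.
    split; first exact: integrable_diff.
    by rewrite iterS ft_abs2_diff// IH exprS mulrA.
  by have [] := gen j.
have c4 : 0 < 4 ^+ j :> R by rewrite exprn_gt0.
rewrite -(ler_pM2l c4) -h iter_diff_box// ft_abs2_scale; last exact: integrable_iter_box.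
rewrite (le_trans (ler_wpM2l _ (ft_abs2_iter_box j t s0 fji))) ?sqr_ge0//.
rewrite le_eqVlt; apply/orP; left; apply/eqP.
rewrite !mulrA -exprMn -!exprM [(j * 2)%N]mulnC exprM -exprMn.
by congr (_ ^+ _ * _); field.
Qed.

End derivative_decay.

(** * Bias-variance decomposition of the risk *)

Section bias_variance.
Context {R : realType}.
Notation mu := (@lebesgue_measure R).
Notation L1 g := (mu.-integrable setT (EFin \o g)).
Implicit Types (f g k K a : R -> R) (c h t x y : R).

(** Only samples of length n are seen, which lets the normalisation by [size s] in [kde] be replaced
    by a constant. *)
Lemma eq_Eiid f n (g g' : seq R -> \bar R) :
  (forall s : seq R, size s = n -> g s = g' s) -> Eiid f n g = Eiid f n g'.
Proof.
elim: n g g' => [|n IH] g g' gg' /=; first exact: gg'.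
apply: eq_integral => x _; congr (_ * _)%E.
by apply: IH => s sn; apply: gg' => /=; rewrite sn.
Qed.

Lemma integrable_density f : is_density f -> L1 f.
Proof. by move=> [mf f0 f1]; apply: ge0_integrable => //; rewrite f1 ltry. Qed.

Section variance.
Variables (f k : R -> R) (M : R).
Hypothesis df : is_density f.
Hypothesis ki : L1 k.
Hypothesis kM : forall x, `|k x| <= M.

Let fi : L1 f. Proof. exact: integrable_density. Qed.
Let mf : measurable_fun setT f. Proof. by case: df. Qed.
Let f0 x : 0 <= f x. Proof. by case: df. Qed.
Let f1 : (\int[mu]_x (f x)%:E = 1)%E. Proof. by case: df. Qed.
Let mk : measurable_fun setT k.
Proof. by move/measurable_int/measurable_EFinP : ki. Qed.
Let m := convolution k f.
Let mm : measurable_fun setT m.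
Proof.
by move/measurable_int/measurable_EFinP : (integrable_convolution ki kM fi).
Qed.

Let mkx x : measurable_fun setT (fun y => k (x - y)).
Proof. by apply: (measurableT_comp mk); exact: measurable_funB. Qed.

Let kf x : L1 (fun y => k (x - y) * f y).
Proof. exact: integrable_convolution_section fi x. Qed.

Let k2f x : L1 (fun y => k (x - y) ^+ 2 * f y).
Proof.
apply: (@bounded_integrableM _ _ _ (M ^+ 2)) => //; first exact: measurable_funX.
move=> y; rewrite normrX ler_sqr ?nnegrE//.
exact: le_trans (kM 0).
Qed.

(** For X with density f, [m x], [q x] and [v x] are the mean, second moment and variance of k (x -
    X). *)
Let q x := \int[mu]_y (k (x - y) ^+ 2 * f y).
Let v x := q x - m x ^+ 2.

Let second_moment x (al c : R) :
  (\int[mu]_y (f y * (al + c * k (x - y)) ^+ 2)%:E =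
   ((al + c * m x) ^+ 2 + c ^+ 2 * v x)%:E)%E.
Proof.
have i1 := integrable_scale (al ^+ 2) fi.
have i2 := integrable_scale (2 * al * c) (kf x).
have i3 := integrable_scale (c ^+ 2) (k2f x).
have i12 := integrableD measurableT i1 i2.
have i123 := integrableD measurableT i12 i3.
have rE y : f y * (al + c * k (x - y)) ^+ 2 = al ^+ 2 * f y +
  2 * al * c * (k (x - y) * f y) + c ^+ 2 * (k (x - y) ^+ 2 * f y) by ring.
under eq_integral do rewrite rE.
have F1 : \int[mu]_y f y = 1 by rewrite /Rintegral f1.
transitivity ((\int[mu]_y (al ^+ 2 * f y +
  2 * al * c * (k (x - y) * f y) + c ^+ 2 * (k (x - y) ^+ 2 * f y)))%:E).
  by rewrite /Rintegral fineK//; exact: integrable_fin_num i123.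
congr EFin; rewrite RintegralD// RintegralD// !RintegralZl// F1.
by rewrite /v /q /m /convolution; ring.
Qed.

Let v_ge0 x : 0 <= v x.
Proof.
(* This choice centres the variable, so the variance itself becomes the integral of a nonnegative
   function. *)
have := second_moment x (- m x) 1; rewrite mul1r addNr expr0n/= add0r expr1n mul1r.
move=> E; rewrite -lee_fin -E; apply: integral_ge0 => y _.
by rewrite lee_fin mulr_ge0// sqr_ge0.
Qed.

Let mkxy : measurable_fun setT (fun z : R * R => k (z.1 - z.2)).
Proof. by apply: (measurableT_comp mk); exact: measurable_funB. Qed.

Let mk2f : measurable_fun setT (fun z : R * R => (k (z.1 - z.2) ^+ 2 * f z.2)%:E).
Proof.
apply/measurable_EFinP; apply: measurable_funM; first exact: measurable_funX.
exact: measurableT_comp mf _.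
Qed.

Let qE x : ((q x)%:E = \int[mu]_y (k (x - y) ^+ 2 * f y)%:E)%E.
Proof. by rewrite /q /Rintegral fineK//; exact: integrable_fin_num (k2f x). Qed.

Let k2f_ge0 (z : R * R) : (0 <= (k (z.1 - z.2) ^+ 2 * f z.2)%:E)%E.
Proof. by rewrite lee_fin mulr_ge0// sqr_ge0. Qed.

Let mq : measurable_fun setT q.
Proof.
apply/measurable_EFinP.
apply: eq_measurable_fun (@measurable_fun_fubini_tonelli_F _ _ _ _ _ mu _ mk2f k2f_ge0) => x _.
by rewrite /= qE.
Qed.

Let mv : measurable_fun setT v.
Proof. by apply: measurable_funB => //; exact: measurable_funX. Qed.

(** The variance is below the second moment, whose integral factors by Tonelli and translation
    invariance into that of k^2 times that of f, the latter being 1. *)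
Let integral_v : (\int[mu]_x (v x)%:E <= \int[mu]_x (k x ^+ 2)%:E)%E.
Proof.
apply: (@le_trans _ _ (\int[mu]_x (q x)%:E)%E).
  apply: ge0_le_integral => //.
  - by move=> x _; rewrite lee_fin.
  - by apply/measurable_EFinP.
  - by apply/measurable_EFinP.
  - by move=> x _; rewrite lee_fin /v gerBl sqr_ge0.
under eq_integral do rewrite qE.
rewrite (@fubini_tonelli _ _ _ _ _ mu mu _ mk2f k2f_ge0)/=.
rewrite -[leRHS]mule1 -f1 -ge0_integralZl//; first last.
- by apply: integral_ge0 => x _; rewrite lee_fin sqr_ge0.
- by move=> x _; rewrite lee_fin.
- by apply/measurable_EFinP.
rewrite le_eqVlt; apply/orP; left; apply/eqP; apply: eq_integral => y _.
under eq_integral do rewrite EFinM.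
rewrite ge0_integralZr//; last 3 first.
- by apply/measurable_EFinP; apply: measurable_funX;
    apply: (measurableT_comp mk); exact: measurable_funB.
- by move=> x _; rewrite lee_fin sqr_ge0.
- by rewrite lee_fin.
congr (_ * _)%E.
have := @ge0_integral_affine _ 1 (- y) (fun x => (k x ^+ 2)%:E) (oner_neq0 R).
rewrite normr1 invr1 mul1e => <-//.
- by apply: eq_integral => x _; rewrite mul1r.
- by apply/measurable_EFinP; exact: measurable_funX.
- by move=> x; rewrite lee_fin sqr_ge0.
Qed.

(** The offset [a] is general for the sake of the induction: once the first observation y is fixed,
    it becomes a x + c k (x - y). All integrands are nonnegative, so infinite values do no harm. *)
Lemma Eiid_l2_risk n a c : measurable_fun setT a ->
  (Eiid f n (fun s => \int[mu]_x ((a x + c * \sum_(X <- s) k (x - X)) ^+ 2)%:E) =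
   \int[mu]_x ((a x + n%:R * c * m x) ^+ 2)%:E +
   (n%:R * c ^+ 2)%:E * \int[mu]_x (v x)%:E)%E.
Proof.
elim: n a => [|n IH] a ma /=.
  rewrite [X in (X%:E * _)%E]mul0r mul0e adde0; apply: eq_integral => x _.
  by rewrite big_nil mulr0 !mul0r.
pose A x := a x + n%:R * c * m x.
have mA : measurable_fun setT A.
  by apply: measurable_funD => //; apply: measurable_funM.
pose V := (\int[mu]_x (v x)%:E)%E.
have V0 : (0 <= V)%E by apply: integral_ge0 => x _; rewrite lee_fin.
have nc0 (l : nat) : (0 <= (l%:R * c ^+ 2)%:E)%E by rewrite lee_fin mulr_ge0// sqr_ge0.
have E y : (Eiid f n (fun s => \int[mu]_x ((a x + c * \sum_(X <- y :: s) k (x - X)) ^+ 2)%:E) =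
   \int[mu]_x ((A x + c * k (x - y)) ^+ 2)%:E + (n%:R * c ^+ 2)%:E * V)%E.
  have ma' : measurable_fun setT (fun x => a x + c * k (x - y)).
    apply: measurable_funD => //; apply: measurable_funM => //.
    by apply: (measurableT_comp mk); exact: measurable_funB.
  have := IH _ ma'.
  rewrite (_ : (fun x => ((a x + c * k (x - y) + n%:R * c * m x) ^+ 2)%:E) =
    (fun x => ((A x + c * k (x - y)) ^+ 2)%:E)); last first.
    by apply/funext => x; rewrite /A; congr EFin; ring.
  move=> <-; apply: eq_Eiid => s _; apply: eq_integral => x _.
  by rewrite big_cons mulrDr addrA.
under eq_integral do rewrite E.
(* Tonelli exchanges the first observation with x, so that [second_moment] applies at each x with al
   = A x. *)
pose S (z : R * R) : \bar R := (f z.2 * (A z.1 + c * k (z.1 - z.2)) ^+ 2)%:E.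
have mS : measurable_fun setT S.
  apply/measurable_EFinP; apply: measurable_funM; first exact: measurableT_comp mf _.
  apply: measurable_funX; apply: measurable_funD; first exact: measurableT_comp mA _.
  by apply: measurable_funM => //.
have S0 z : (0 <= S z)%E by rewrite lee_fin mulr_ge0// sqr_ge0.
have inner y : ((f y)%:E * (\int[mu]_x ((A x + c * k (x - y)) ^+ 2)%:E +
    (n%:R * c ^+ 2)%:E * V) = \int[mu]_x S (x, y) + (n%:R * c ^+ 2)%:E * V * (f y)%:E)%E.
  rewrite ge0_muleDr; last 2 first.
  - by apply: integral_ge0 => x _; rewrite lee_fin sqr_ge0.
  - by rewrite mule_ge0.
  rewrite -ge0_integralZl//; last 3 first.
  - apply/measurable_EFinP; apply: measurable_funX; apply: measurable_funD => //.
    apply: measurable_funM => //.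
    by apply: (measurableT_comp mk); exact: measurable_funB.
  - by move=> x _; rewrite lee_fin sqr_ge0.
  - by rewrite lee_fin.
  by rewrite [X in (_ + X)%E]muleC.
under eq_integral do rewrite inner.
rewrite ge0_integralD//; last 4 first.
- by move=> y _; exact: integral_ge0.
- exact: (@measurable_fun_fubini_tonelli_G _ _ _ _ _ mu S mS S0).
- by move=> y _; rewrite mule_ge0// ?mule_ge0// lee_fin.
- by apply: measurable_funeM; apply/measurable_EFinP.
rewrite ge0_integralZl//; last 3 first.
- by apply/measurable_EFinP.
- by move=> y _; rewrite lee_fin.
- by rewrite mule_ge0.
rewrite f1 mule1 -(@fubini_tonelli _ _ _ _ _ mu mu S mS S0) /S/=.
under eq_integral do rewrite second_moment EFinD [(c ^+ 2 * v _)%:E]EFinM.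
rewrite ge0_integralD//; last 4 first.
- by move=> x _; rewrite lee_fin sqr_ge0.
- apply/measurable_EFinP; apply: measurable_funX; apply: measurable_funD => //.
  exact: measurable_funM.
- by move=> x _; rewrite mule_ge0// lee_fin ?sqr_ge0.
- by apply: measurable_funeM; apply/measurable_EFinP.
rewrite ge0_integralZl//; last 3 first.
- by apply/measurable_EFinP.
- by move=> x _; rewrite lee_fin.
- by rewrite lee_fin sqr_ge0.
rewrite -addeA; congr (_ + _)%E.
  by apply: eq_integral => x _; congr EFin; rewrite /A -natr1; ring.
rewrite -/V -ge0_muleDl; last 2 first.
- by rewrite lee_fin sqr_ge0.
- exact: nc0.
by rewrite -EFinD; congr (_%:E * _)%E; rewrite -natr1; ring.
Qed.

Lemma Eiid_l2_risk_le n a c : measurable_fun setT a ->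
  (Eiid f n (fun s => \int[mu]_x ((a x + c * \sum_(X <- s) k (x - X)) ^+ 2)%:E) <=
   \int[mu]_x ((a x + n%:R * c * m x) ^+ 2)%:E +
   (n%:R * c ^+ 2)%:E * \int[mu]_x (k x ^+ 2)%:E)%E.
Proof.
move=> ma; rewrite Eiid_l2_risk// leeD2l// lee_wpmul2l//.
by rewrite lee_fin mulr_ge0// sqr_ge0.
Qed.

End variance.

Section rescaled_kernel.
Variables (K : R -> R) (h : R).
Hypothesis h0 : 0 < h.
Hypothesis Ki : L1 K.

Let hV : h^-1 != 0. Proof. by rewrite invr_neq0// gt_eqF. Qed.

(** The trailing 0 gives the argument the shape a * x + b of the change-of-variables lemmas. *)
Lemma KhE : Kh K h = (fun x => h^-1 * K (h^-1 * x + 0)).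
Proof. by apply/funext => x; rewrite /Kh addr0 mulrC [x / h]mulrC. Qed.

Lemma integrable_Kh : L1 (Kh K h).
Proof. by rewrite KhE; apply: integrable_scale; exact: integrable_affine. Qed.

Lemma Kh_le M : (forall x, `|K x| <= M) -> forall x, `|Kh K h x| <= h^-1 * M.
Proof.
by move=> KM x; rewrite KhE normrM gtr0_norm ?invr_gt0// ler_wpM2l ?invr_ge0 ?(ltW h0).
Qed.

Lemma integral_Kh_sqr :
  (\int[mu]_x (Kh K h x ^+ 2)%:E = (h^-1)%:E * \int[mu]_x (K x ^+ 2)%:E)%E.
Proof.
have mK : measurable_fun setT K by move/measurable_int/measurable_EFinP : Ki.
have mK2 : measurable_fun setT (fun x => (K x ^+ 2)%:E).
  by apply/measurable_EFinP; exact: measurable_funX.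
have K20 x : (0 <= (K x ^+ 2)%:E)%E by rewrite lee_fin sqr_ge0.
rewrite KhE; under eq_integral do rewrite exprMn EFinM.
rewrite ge0_integralZl//; last 2 first.
- by apply: (measurableT_comp mK2); exact: measurable_affine.
- by rewrite lee_fin sqr_ge0.
rewrite (ge0_integral_affine 0 hV mK2 K20) muleA -EFinM; congr (_%:E * _)%E.
by rewrite gtr0_norm ?invr_gt0// invrK expr2 -mulrA mulVf ?mulr1// gt_eqF.
Qed.

Lemma ft_re_Kh t : ft_re (Kh K h) t = ft_re K (h * t).
Proof.
have := Rintegral_affine 0 hV (integrable_cosM (h * t) Ki).
rewrite gtr0_norm ?invr_gt0// invrK => /(congr1 ( *%R h^-1)).
rewrite mulrA mulVf ?gt_eqF// mul1r -ft_reE => <-.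
rewrite -RintegralZl//; last exact: (integrable_affine 0 hV (integrable_cosM (h * t) Ki)).
rewrite ft_reE KhE; apply: eq_Rintegral => x _; rewrite addr0.
rewrite (_ : h * t * (h^-1 * x) = t * x); first by ring.
by field; rewrite gt_eqF.
Qed.

Lemma ft_im_Kh t : ft_im (Kh K h) t = ft_im K (h * t).
Proof.
have := Rintegral_affine 0 hV (integrable_sinM (h * t) Ki).
rewrite gtr0_norm ?invr_gt0// invrK => /(congr1 ( *%R h^-1)).
rewrite mulrA mulVf ?gt_eqF// mul1r -ft_imE => <-.
rewrite -RintegralZl//; last exact: (integrable_affine 0 hV (integrable_sinM (h * t) Ki)).
rewrite ft_imE KhE; apply: eq_Rintegral => x _; rewrite addr0.
rewrite (_ : h * t * (h^-1 * x) = t * x); first by ring.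
by field; rewrite gt_eqF.
Qed.

End rescaled_kernel.

Lemma MISE_le f K h M n : is_density f -> L1 K -> (forall x, `|K x| <= M) ->
  0 < h -> (0 < n)%N ->
  (MISE f K n h <= \int[mu]_x ((convolution (Kh K h) f x - f x) ^+ 2)%:E +
    ((n%:R * h)^-1)%:E * \int[mu]_x (K x ^+ 2)%:E)%E.
Proof.
move=> df Ki KM h0 n0; have [mf _ _] := df.
have nn : n%:R != 0 :> R by rewrite pnatr_eq0 -lt0n.
have mNf : measurable_fun setT (fun x => - f x) by exact: measurable_funN.
(* Offset -f and weight 1/n: the deterministic part is the bias, and n (1/n)^2 times the integral of
   the squared rescaled kernel gives the 1 / (n h) term. *)
have := Eiid_l2_risk_le df (integrable_Kh h0 Ki) (Kh_le h0 KM) n n%:R^-1 mNf.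
rewrite (integral_Kh_sqr h0 Ki) muleA -EFinM.
have -> : n%:R * n%:R^-1 ^+ 2 * h^-1 = (n%:R * h)^-1 :> R.
  by field; rewrite nn gt_eqF.
move=> H; apply: le_trans (le_trans H _).
  rewrite /MISE le_eqVlt; apply/orP; left; apply/eqP; apply: eq_Eiid => s sn.
  by apply: eq_integral => x _; congr EFin; rewrite /kde sn addrC.
rewrite leeD2r// le_eqVlt; apply/orP; left; apply/eqP.
by apply: eq_integral => x _; rewrite divff// mul1r addrC.
Qed.

End bias_variance.

(** * Rates of convergence *)

Section risk.
Context {R : realType}.
Notation mu := (@lebesgue_measure R).
Notation L1 g := (mu.-integrable setT (EFin \o g)).
Implicit Types (f g K w : R -> R) (h t r : R).

(** Any s0 strictly below the infimum works for t >= 0. The infimum says nothing about negative t;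
    there the cosine transform is even and the sine transform odd. *)
Lemma S_K_gt0 K : L1 K -> (0%:E < S_K K)%E -> exists2 s0 : R, 0 < s0 &
  forall t, `|t| <= s0 -> ft_re K t = 1 /\ ft_im K t = 0.
Proof.
move=> Ki SK0.
have [s0 s00 sS] : exists2 s0 : R, 0 < s0 & (s0%:E < S_K K)%E.
  move: SK0; case: (S_K K) => [r| |//]; last by exists 1; rewrite ?ltry.
  by rewrite lte_fin => r0; exists (r / 2); rewrite ?lte_fin; lra.
have key t : 0 <= t -> t <= s0 -> ft_re K t = 1 /\ ft_im K t = 0.
  move=> t0 ts; apply: contrapT => nE.
  have : (S_K K <= t%:E)%E.
    by apply: ereal_inf_lbound; exists t => //; split => // -[re im]; apply: nE.
  by apply/negP; rewrite -ltNge (le_lt_trans _ sS)// lee_fin.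
have reN t : ft_re K (- t) = ft_re K t.
  by rewrite !ft_reE; apply: eq_Rintegral => x _; rewrite mulNr cosN.
exists s0 => // t; have [t0 ts|t0 ts] := ger0P t; first exact: key.
have [] := key (- t) _ ts; first by rewrite oppr_ge0 ltW.
rewrite reN => -> im; split => //.
have sE x : sin (t * x) * K x = -1 * (sin (- t * x) * K x) by rewrite [- t * x]mulNr sinN; ring.
rewrite ft_imE; under eq_Rintegral do rewrite sE.
rewrite RintegralZl//; last exact: integrable_sinM.
by rewrite -ft_imE im mulr0.
Qed.

(** The pair (r, w) separates the small factor from an integrable weight so that both cases are
    covered: (c h^(2k), |(f^(k))^|^2) in the smooth one, (1/n, e^{gamma |t|^alpha} |f^|^2) in the
    supersmooth one. The 2 / pmass comes from [l2_le_ft]. *)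
Lemma bias_le K f M s0 h r w : L1 K -> (forall x, `|K x| <= M) -> L1 f ->
  0 < h -> 0 <= r ->
  (forall t, `|t| <= s0 -> ft_re K t = 1 /\ ft_im K t = 0) ->
  measurable_fun setT w -> (forall t, 0 <= w t) ->
  (forall t, s0 < h * `|t| -> ft_abs2 f t <= r * w t) ->
  (\int[mu]_x ((convolution (Kh K h) f x - f x) ^+ 2)%:E <=
   (2 * (2 + 4 * (\int[mu]_x `|K x|) ^+ 2) / pmass * r)%:E * \int[mu]_t (w t)%:E)%E.
Proof.
move=> Ki KM fi h0 r0 Ks mw w0 fw.
have khi := integrable_Kh h0 Ki; have khM := Kh_le h0 KM.
pose g x := convolution (Kh K h) f x - f x.
have gi : L1 g.
  have := integrableB measurableT (integrable_convolution khi khM fi) fi.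
  by apply: eq_integrable.
set N := \int[mu]_x `|K x|; have N0 : 0 <= N by exact: Rintegral_ge0.
pose Q : R := 2 + 4 * N ^+ 2.
have Q0 : 0 <= Q by rewrite addr_ge0// mulr_ge0// sqr_ge0.
have p0 := @pmass_gt0 R.
have gft t : ft_abs2 g t <= Q * r * w t.
  rewrite /g (ft_abs2_convolutionB khi khM fi) (ft_re_Kh h0 Ki) (ft_im_Kh h0 Ki).
  have [ts|ts] := leP (h * `|t|) s0.
    have [->->] : ft_re K (h * t) = 1 /\ ft_im K (h * t) = 0.
      by apply: Ks; rewrite normrM gtr0_norm.
    by rewrite subrr expr0n/= addr0 mul0r mulr_ge0 ?w0// mulr_ge0.
  rewrite -mulrA ler_pM ?ft_abs2_ge0 ?addr_ge0 ?sqr_ge0 ?fw//.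
  have re := norm_ft_re_le (h * t) Ki; have im := norm_ft_im_le (h * t) Ki.
  have re2 : ft_re K (h * t) ^+ 2 <= N ^+ 2.
    by rewrite -[leLHS]real_normK ?num_real// ler_sqr ?nnegrE.
  have im2 : ft_im K (h * t) ^+ 2 <= N ^+ 2.
    by rewrite -[leLHS]real_normK ?num_real// ler_sqr ?nnegrE.
  (* From (u - 1)^2 <= 2 + 2 u^2 the factor |K^ - 1|^2 is at most 2 + 3 N^2, hence at most [Q]. *)
  have := sqr_ge0 (ft_re K (h * t) + 1); have := sqr_ge0 N; rewrite /Q; lra.
have := l2_le_ft gi; rewrite -lee_pdivlMl// => /le_trans; apply.
have cE : (2 * Q / pmass * r)%:E = ((pmass^-1)%:E * (2%:E * (Q * r)%:E))%E.
  by rewrite -!EFinM; congr EFin; ring.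
rewrite cE -!muleA; apply: lee_wpmul2l; first by rewrite lee_fin invr_ge0 ltW.
apply: lee_wpmul2l; first by rewrite lee_fin.
rewrite -ge0_integralZl//; last 3 first.
- by apply/measurable_EFinP.
- by move=> t _; rewrite lee_fin.
- by rewrite lee_fin mulr_ge0.
apply: ge0_le_integral => //.
- by move=> t _; rewrite lee_fin ft_abs2_ge0.
- by apply/measurable_EFinP; exact: measurable_ft_abs2.
- by apply: measurable_funeM; apply/measurable_EFinP.
- by move=> t _; rewrite -EFinM lee_fin gft.
Qed.

Lemma Phi_le f K M (I s0 h r : R) w n :
  is_density f -> L1 K -> (forall x, `|K x| <= M) -> in_L2 K ->
  0 < h -> 0 <= r -> (0 < n)%N ->
  (forall t, `|t| <= s0 -> ft_re K t = 1 /\ ft_im K t = 0) ->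
  measurable_fun setT w -> (forall t, 0 <= w t) ->
  (\int[mu]_t (w t)%:E <= I%:E)%E ->
  (forall t, s0 < h * `|t| -> ft_abs2 f t <= r * w t) ->
  (Phi n f K <= (2 * (2 + 4 * (\int[mu]_x `|K x|) ^+ 2) / pmass * I * r +
    (\int[mu]_x K x ^+ 2) * (n%:R * h)^-1)%:E)%E.
Proof.
move=> df Ki KM [K2 _] h0 r0 n0 Ks mw w0 wI fw.
apply: (@le_trans _ _ (MISE f K n h)).
  by apply: ereal_inf_lbound; exists h.
apply: (le_trans (MISE_le df Ki KM h0 n0)); rewrite EFinD leeD//.
  apply: (le_trans (bias_le Ki KM (integrable_density df) h0 r0 Ks mw w0 fw)).
  have p0 := @pmass_gt0 R.
  set c := 2 * _ / pmass.
  have c0 : 0 <= c by rewrite /c divr_ge0 ?(ltW p0)// mulr_ge0// addr_ge0// mulr_ge0// sqr_ge0.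
  rewrite (_ : (c * I * r)%:E = ((c * r)%:E * I%:E)%E); last first.
    by rewrite -EFinM mulrAC.
  by apply: lee_wpmul2l => //; rewrite lee_fin mulr_ge0.
rewrite EFinM muleC; apply: lee_wpmul2r.
  by rewrite lee_fin invr_ge0 mulr_ge0// ltW.
by rewrite /Rintegral fineK//; exact: integrable_fin_num K2.
Qed.

Lemma smooth_rate K f k : is_kernel K -> in_L2 K -> (0%:E < S_K K)%E ->
  is_density f ->
  (forall j : nat, (j < k)%N -> forall x : R, derivable (derive1n j f) x 1) ->
  L1 (derive1n k f) -> in_L2 (derive1n k f) ->
  exists C : R, forall n : nat, (1 <= n)%N ->
    ((n%:R `^ (2 * k%:R / (2 * k%:R + 1)))%:E * Phi n f K <= C%:E)%E.
Proof.
move=> [Ki _ [M KM] _ _] K2 SK df dfk fki [fk2 _].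
have [s0 s00 Ks] := S_K_gt0 Ki SK; have fi := integrable_density df.
(* For |t| > s0 / h the decay factor ((pi / |t|)^2 / 2)^k is at most c h^(2k). *)
pose c := ((pi / s0) ^+ 2 / 2) ^+ k : R.
have c0 : 0 <= c by rewrite exprn_ge0// divr_ge0// sqr_ge0.
set A := 2 * (2 + 4 * (\int[mu]_x `|K x|) ^+ 2) / pmass *
  (pmass * \int[mu]_x derive1n k f x ^+ 2).
exists (A * c + \int[mu]_x K x ^+ 2) => n n0.
set p := 2 * k%:R / (2 * k%:R + 1) : R.
have n1 : 0 < n%:R :> R by rewrite ltr0n.
have k1 : 0 < 2 * k%:R + 1 :> R by rewrite ltr_wpDl// mulr_ge0.
(* This bandwidth balances the squared bias, of order h^(2k), against the variance, of order 1 / (n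
   h): both equal n^(-p), as [hk] and [hn] record. *)
pose h := n%:R `^ (- (2 * k%:R + 1)^-1) : R.
have h0 : 0 < h by exact: powR_gt0.
have hk : n%:R `^ p * h ^+ (2 * k) = 1.
  rewrite /h -powR_mulrn ?powR_ge0// -powRrM -powRD; last first.
    by apply/implyP => _; rewrite gt_eqF.
  rewrite (_ : p + _ = 0) ?powRr0// /p natrM; field; exact: lt0r_neq0.
have hn : n%:R `^ p * (n%:R * h)^-1 = 1.
  rewrite (_ : n%:R * h = n%:R `^ p) ?divff// ?gt_eqF ?powR_gt0//.
  rewrite /h -{1}(powRr1 (ltW n1)) -powRD; last by apply/implyP => _; rewrite gt_eqF.
  by congr (_ `^ _); rewrite /p; field; exact: lt0r_neq0.
have r0 : 0 <= c * h ^+ (2 * k) by rewrite mulr_ge0// exprn_ge0// ltW.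
have fw t : s0 < h * `|t| ->
    ft_abs2 f t <= c * h ^+ (2 * k) * ft_abs2 (derive1n k f) t.
  move=> ht; have t0 : 0 < `|t|.
    by rewrite -(pmulr_rgt0 _ h0) (lt_trans s00).
  have tn : t != 0 by rewrite -normr_gt0.
  rewrite (le_trans (ft_abs2_derive1n_le tn fi dfk fki))// ler_wpM2r ?ft_abs2_ge0//.
  have u0 : 0 <= pi / `|t| :> R by rewrite divr_ge0 ?pi_ge0.
  have v0 : 0 <= pi / s0 * h by rewrite mulr_ge0 ?divr_ge0 ?pi_ge0 ?(ltW h0) ?(ltW s00).
  have uv : pi / `|t| <= pi / s0 * h.
    rewrite ler_pdivrMr// -!mulrA ler_peMr ?pi_ge0//.
    by rewrite ler_pdivlMl// mulr1 ltW.
  have uv2 : (pi / `|t|) ^+ 2 / 2 <= (pi / s0) ^+ 2 / 2 * h ^+ 2.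
    by rewrite [leRHS]mulrAC -exprMn ler_pM2r ?invr_gt0// ler_sqr.
  rewrite /c exprM -exprMn lerXn2r// nnegrE.
    by rewrite divr_ge0// sqr_ge0.
  by rewrite mulr_ge0 ?sqr_ge0// divr_ge0 ?sqr_ge0.
have := Phi_le df Ki KM K2 h0 r0 n0 Ks (measurable_ft_abs2 fki)
  (ft_abs2_ge0 (derive1n k f)) (integral_ft_abs2_le fki fk2) fw.
rewrite -/A => H; apply: (le_trans (lee_wpmul2l _ H)); first by rewrite lee_fin powR_ge0.
rewrite -EFinM lee_fin mulrDr [X in _ + X]mulrCA hn mulr1 lerD2r.
by rewrite mulrCA [n%:R `^ p * _]mulrCA hk mulr1.
Qed.

Lemma supersmooth_rate K f (alpha gamma : R) :
  is_kernel K -> in_L2 K -> (0%:E < S_K K)%E -> is_density f ->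
  0 < alpha -> 0 < gamma ->
  (\int[mu]_t ((expR (gamma * `|t| `^ alpha) * ft_abs2 f t)%:E) < +oo)%E ->
  exists C : R, forall n : nat, (2 <= n)%N ->
    ((n%:R / (ln n%:R) `^ (alpha^-1))%:E * Phi n f K <= C%:E)%E.
Proof.
move=> [Ki _ [M KM] _ _] K2 SK df a0 g0 Ioo.
have [s0 s00 Ks] := S_K_gt0 Ki SK; have fi := integrable_density df.
pose w t := expR (gamma * `|t| `^ alpha) * ft_abs2 f t.
have w0 t : 0 <= w t by rewrite mulr_ge0 ?expR_ge0 ?ft_abs2_ge0.
have mw : measurable_fun setT w.
  apply: measurable_funM; last exact: measurable_ft_abs2.
  apply: (measurableT_comp (@measurable_expR R)).
  apply: measurable_funM; first exact: measurable_cst.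
  apply: (measurableT_comp (measurable_powR alpha)).
  exact: normr_measurable.
pose I := fine (\int[mu]_t (w t)%:E).
have IE : (\int[mu]_t (w t)%:E <= I%:E)%E.
  rewrite /I fineK// ge0_fin_numE//.
  by apply: integral_ge0 => t _; rewrite lee_fin.
have I0 : 0 <= I by rewrite fine_ge0//; apply: integral_ge0 => t _; rewrite lee_fin.
set A := 2 * (2 + 4 * (\int[mu]_x `|K x|) ^+ 2) / pmass * I.
have A0 : 0 <= A.
  by rewrite /A mulr_ge0// divr_ge0 ?(ltW pmass_gt0)// mulr_ge0// addr_ge0// mulr_ge0// sqr_ge0.
set B := \int[mu]_x K x ^+ 2.
(* After multiplication by n / (ln n)^(1/alpha), the bias A / n becomes A / (ln n)^(1/alpha),
   largest at n = 2, while the variance term becomes independent of n. *)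
exists (A * ((ln 2) `^ alpha^-1)^-1 + B * (gamma^-1 `^ alpha^-1 / s0)) => n n2.
have n0 : (0 < n)%N by exact: leq_trans n2.
have n1 : 0 < n%:R :> R by rewrite ltr0n.
have l2 : 0 < ln 2 :> R by rewrite ln_gt0// ltr1n.
have ln2n : ln 2 <= ln n%:R :> R by rewrite ler_ln ?posrE// ler_nat.
have ln0 : 0 < ln n%:R :> R by exact: lt_le_trans ln2n.
(* The frequency at which e^{gamma L^alpha} = n: beyond it the weight in [w] exceeds n, and h = s0 /
   L leaves lower frequencies free of bias. *)
pose L := (ln n%:R / gamma) `^ alpha^-1 : R.
have L0 : 0 < L by rewrite powR_gt0// divr_gt0.
pose h := s0 / L.
have h0 : 0 < h by rewrite divr_gt0.
have r0 : 0 <= n%:R^-1 :> R by rewrite invr_ge0.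
have fw t : s0 < h * `|t| -> ft_abs2 f t <= n%:R^-1 * w t.
  rewrite /h mulrAC ltr_pdivlMr// ltr_pM2l// => Lt.
  rewrite ler_pdivlMl// /w ler_wpM2r ?ft_abs2_ge0//.
  rewrite -[leLHS]lnK ?posrE// ler_expR.
  rewrite -ler_pdivrMl// mulrC.
  have -> : ln n%:R / gamma = L `^ alpha.
    by rewrite /L -powRrM mulVf ?gt_eqF// powRr1// divr_ge0// ltW.
  by rewrite ge0_ler_powR ?nnegrE ?(ltW a0) ?(ltW L0) ?(ltW Lt).
have H := Phi_le df Ki KM K2 h0 r0 n0 Ks mw w0 IE fw.
set P := ln n%:R `^ alpha^-1.
have P0 : 0 < P by exact: powR_gt0.
apply: (le_trans (lee_wpmul2l _ H)); first by rewrite lee_fin divr_ge0// ltW.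
rewrite -/A -/B -EFinM lee_fin.
have hE : (n%:R * h)^-1 = P * gamma^-1 `^ alpha^-1 / s0 / n%:R.
  rewrite /h /L powRM ?invr_ge0 ?(ltW ln0) ?(ltW g0)// -/P.
  have q0 : gamma^-1 `^ alpha^-1 != 0 by rewrite gt_eqF// powR_gt0// invr_gt0.
  by field; rewrite ?q0 !gt_eqF.
have -> : n%:R / P * (A / n%:R + B * (n%:R * h)^-1) =
    A / P + B * (gamma^-1 `^ alpha^-1 / s0).
  by rewrite hE; field; rewrite !gt_eqF.
rewrite lerD2r ler_wpM2l// lef_pV2 ?posrE ?powR_gt0//.
by rewrite ge0_ler_powR ?nnegrE ?invr_ge0 ?(ltW a0) ?(ltW l2) ?(ltW ln0).
Qed.

End risk.

Theorem theorem5 (R : realType) (K f : R -> R) :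
  is_kernel K -> in_L2 K -> (0%:E < S_K K)%E ->
  is_density f -> in_L2 f ->
  (* (i) smooth case *)
  (forall k : nat, (1 <= k)%N ->
     (forall j : nat, (j < k)%N -> forall x : R, derivable (derive1n j f) x 1) ->
     (@lebesgue_measure R).-integrable setT (EFin \o derive1n k f) ->
     in_L2 (derive1n k f) ->
     exists C : R, forall n : nat, (1 <= n)%N ->
       ((n%:R `^ (2 * k%:R / (2 * k%:R + 1)))%:E * Phi n f K <= C%:E)%E)
  /\
  (* (ii) supersmooth case *)
  (forall alpha gamma : R, 0 < alpha -> 0 < gamma ->
     (\int[@lebesgue_measure R]_t ((expR (gamma * `|t| `^ alpha) * ft_abs2 f t)%:E)
        < +oo)%E ->
     exists C : R, forall n : nat, (2 <= n)%N ->
       ((n%:R / (ln n%:R) `^ (alpha^-1))%:E * Phi n f K <= C%:E)%E).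
Proof.
move=> kK K2 SK df f2; split=> [k k1 dfk fki fk2|alpha gamma a0 g0 Ioo].
  exact: (smooth_rate kK K2 SK df dfk fki fk2).
exact: (supersmooth_rate kK K2 SK df a0 g0 Ioo).
Qed.
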